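(* Let $p$ be a prime number and let $A$ be a one-dimensional, Noetherian, reduced, local $\mathbb F_p$-algebra whose residue field is perfect and such that the normalisation map $A\to\tilde A$ is a finite morphism. Let $F=\operatorname{Frac}A$ be the total quotient ring of $A$. If the canonical map $K_2(A)\to K_2(F)$ is injective, then $A$ is regular.
   Context: All rings are commutative and unital. $\tilde A$ denotes the integral closure of the reduced ring $A$ in its total quotient ring $\operatorname{Frac}A$. $K_2$ is the usual algebraic $K_2$-group. *)

(* Defs.v *)
From HB Require Import structures.
From mathcomp Require Import all_boot all_order all_algebra all_field.
From mathcomp Require Import ring boolp.

Set Implicit Arguments.
Unset Strict Implicit.
Unset Printing Implicit Defensive.

Import GRing.Theory.
Local Open Scope ring_scope.
Local Open Scope quotient_scope.

Section CommutativeAlgebra.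
Variable A : comNzRingType.
Implicit Types (I m : {pred A}).

Definition reduced_ring := forall (x : A) n, x ^+ n = 0 -> x = 0.

(* The library's idealr_closed I says that I is a proper ideal. *)
Definition prime_ideal (P : {pred A}) :=
  idealr_closed P /\ prime_idealr_closed P.

Definition maximal_ideal m :=
  idealr_closed m /\
  forall J : {pred A}, idealr_closed J -> {subset m <= J} -> {subset J <= m}.

Definition ideal_generated_by I (s : seq A) :=
  forall x, x \in I <->
    exists c : 'I_(size s) -> A, x = \sum_(i < size s) c i * s`_i.

(* Only proper ideals need to be tested: the unit ideal is generated by 1. *)
Definition noetherian_ring :=
  forall I, idealr_closed I -> exists s : seq A, ideal_generated_by I s.

Definition local_ring_at m :=
  maximal_ideal m /\ forall m' : {pred A}, maximal_ideal m' -> m' =i m.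

Definition local_ring := exists m, local_ring_at m.

Definition prime_chain (n : nat) (P : nat -> {pred A}) :=
  (forall i, (i <= n)%N -> prime_ideal (P i)) /\
  (forall i, (i < n)%N ->
     {subset P i <= P i.+1} /\ ~ {subset P i.+1 <= P i}).

Definition has_krull_dim (n : nat) :=
  (exists P, prime_chain n P) /\ ~ (exists P, prime_chain n.+1 P).

Definition regular_local_ring :=
  noetherian_ring /\
  exists m, local_ring_at m /\
  exists s : seq A, ideal_generated_by m s /\ has_krull_dim (size s).

(* For A local, pi exhibits k as the residue field of A. *)
Definition is_residue_field (k : fieldType) (pi : {rmorphism A -> k}) :=
  (forall y, exists x, pi x = y) /\
  forall m, maximal_ideal m -> forall x, (x \in m) = (pi x == 0).

(* The localisation of A at its non-zero-divisors; since A is commutative,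
   GRing.lreg s says that s is a non-zero-divisor. *)
Definition is_total_quotient_ring (F : comUnitRingType)
    (iota : {rmorphism A -> F}) :=
  [/\ injective iota,
      forall s : A, GRing.lreg s -> iota s \is a GRing.unit &
      forall y : F, exists a s : A, GRing.lreg s /\ y = iota a / iota s].

(* The A-module structure of F is the one given by iota. *)
Definition finite_normalisation (F : comUnitRingType)
    (iota : {rmorphism A -> F}) :=
  exists s : seq F, forall y : F, integralOver iota y <->
    exists c : 'I_(size s) -> A, y = \sum_(i < size s) iota (c i) * s`_i.

End CommutativeAlgebra.

Definition perfect_field (k : fieldType) :=
  forall q : {poly k}, irreducible_poly q -> separable_poly q.

(* StGen i j _ a is the generator x_ij(a) of the Steinberg group; rows and
   columns are indexed by nat, so that the group presented below is the stable
   Steinberg group. *)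
Record st_gen (R : comNzRingType) := StGen {
  st_row : nat;
  st_col : nat;
  st_neq : st_row != st_col;
  st_coef : R
}.

(* A word in the generators; the letter (true, g) stands for the inverse of g *)
Definition st_word (R : comNzRingType) := seq (bool * st_gen R).

HB.instance Definition _ (R : comNzRingType) := gen_eqMixin (st_word R).
HB.instance Definition _ (R : comNzRingType) := gen_choiceMixin (st_word R).

Section Steinberg.
Variable R : comNzRingType.
Implicit Types (u v w : st_word R) (g : st_gen R).

Definition x_ i j (ij : i != j) (a : R) : bool * st_gen R :=
  (false, StGen ij a).
Definition xV_ i j (ij : i != j) (a : R) : bool * st_gen R :=
  (true, StGen ij a).

Inductive steinberg_eq : st_word R -> st_word R -> Prop :=
| StRefl u : steinberg_eq u u
| StSym u v : steinberg_eq u v -> steinberg_eq v u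
| StTrans u v w : steinberg_eq u v -> steinberg_eq v w -> steinberg_eq u w
| StCat u u' v v' :
    steinberg_eq u u' -> steinberg_eq v v' -> steinberg_eq (u ++ v) (u' ++ v')
| StCancel b g : steinberg_eq [:: (b, g); (~~ b, g)] [::]
| StAdd i j (ij : i != j) a b :
    steinberg_eq [:: x_ ij a; x_ ij b] [:: x_ ij (a + b)]
| StComm i j k l (ij : i != j) (kl : k != l) a b : j != k -> i != l ->
    steinberg_eq [:: x_ ij a; x_ kl b; xV_ ij a; xV_ kl b] [::]
| StMul i j k (ij : i != j) (jk : j != k) (ik : i != k) a b :
    steinberg_eq [:: x_ ij a; x_ jk b; xV_ ij a; xV_ jk b]
                 [:: x_ ik (a * b)].

Definition steinberg_rel u v := `[< steinberg_eq u v >].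

Lemma steinberg_rel_refl : reflexive steinberg_rel.
Proof. by move=> u; apply/asboolP; exact: StRefl. Qed.

Lemma steinberg_rel_sym : symmetric steinberg_rel.
Proof. by move=> u v; apply/asboolP/asboolP; exact: StSym. Qed.

Lemma steinberg_rel_trans : transitive steinberg_rel.
Proof.
move=> v u w /asboolP uv /asboolP vw; apply/asboolP; exact: StTrans uv vw.
Qed.

Canonical steinberg_equiv :=
  EquivRel steinberg_rel steinberg_rel_refl steinberg_rel_sym
    steinberg_rel_trans.

Definition St := {eq_quot steinberg_equiv}.

HB.instance Definition _ : EqQuotient _ steinberg_equiv St := EqQuotient.on St.
HB.instance Definition _ := Choice.on St.

Lemma St_eqP u v : reflect (steinberg_eq u v) (\pi_St u == \pi_St v).
Proof. by rewrite (eqmodE steinberg_equiv); exact: asboolP. Qed.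

Lemma St_repr u : steinberg_eq (repr (\pi_St u)) u.
Proof. by apply/St_eqP; rewrite reprK. Qed.

Definition word_inv u : st_word R := rev [seq (~~ x.1, x.2) | x <- u].

Lemma word_invK : involutive word_inv.
Proof.
move=> u; rewrite /word_inv map_rev revK -map_comp -[RHS]map_id.
by apply: eq_map => -[b g] /=; rewrite negbK.
Qed.

Lemma word_invr u : steinberg_eq (u ++ word_inv u) [::].
Proof.
elim: u => [|[b g] u IHu]; first exact: StRefl.
have -> : ((b, g) :: u) ++ word_inv ((b, g) :: u) =
    [:: (b, g)] ++ ((u ++ word_inv u) ++ [:: (~~ b, g)]).
  by rewrite /word_inv /= rev_cons -cats1 catA.
apply: (StTrans _ (StCancel b g)).
apply: (@StCat [:: (b, g)] [:: (b, g)] ((u ++ word_inv u) ++ _) [:: (~~ b, g)]).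
  exact: StRefl.
exact: (@StCat (u ++ word_inv u) [::] [:: (~~ b, g)] _ IHu (StRefl _)).
Qed.

Lemma word_invl u : steinberg_eq (word_inv u ++ u) [::].
Proof. by rewrite -{2}[u]word_invK; exact: word_invr. Qed.

Definition St_one : St := \pi_St [::].
Definition St_mul (x y : St) : St := \pi_St (repr x ++ repr y).
Definition St_inv (x : St) : St := \pi_St (word_inv (repr x)).

Lemma St_mul_pi u v : St_mul (\pi_St u) (\pi_St v) = \pi_St (u ++ v).
Proof. by apply/eqP/St_eqP; apply: StCat; exact: St_repr. Qed.

Lemma St_mulA : associative St_mul.
Proof.
move=> x y z; rewrite -[x]reprK -[y]reprK -[z]reprK.
rewrite (St_mul_pi (repr x) (repr y)) (St_mul_pi (repr y) (repr z)).
by rewrite (St_mul_pi (repr x)) (St_mul_pi _ (repr z)) catA.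
Qed.

Lemma St_mul1 : left_id St_one St_mul.
Proof. by move=> x; rewrite -[x]reprK St_mul_pi. Qed.

Lemma St_1mul : right_id St_one St_mul.
Proof. by move=> x; rewrite -[x]reprK St_mul_pi cats0. Qed.

Lemma St_mulV : left_inverse St_one St_inv St_mul.
Proof.
move=> x; rewrite -{2}[x]reprK St_mul_pi; apply/eqP/St_eqP; exact: word_invl.
Qed.

Lemma St_Vmul : right_inverse St_one St_inv St_mul.
Proof.
move=> x; rewrite -{1}[x]reprK St_mul_pi; apply/eqP/St_eqP; exact: word_invr.
Qed.

HB.instance Definition _ :=
  isGroup.Build St St_mulA St_mul1 St_1mul St_mulV St_Vmul.

Lemma St_mulE u v : (\pi_St u * \pi_St v)%g = \pi_St (u ++ v).
Proof. exact: St_mul_pi. Qed.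

(* Infinite matrices with rows and columns indexed by nat. *)
Definition infmx := nat -> nat -> R.

Definition infmx1 : infmx := fun k l => (k == l)%:R.

(* Left multiplication by the elementary matrix e_ij(a) = 1 + a E_ij,
   or by its inverse e_ij(- a) *)
Definition letter_act (x : bool * st_gen R) (M : infmx) : infmx :=
  let: (b, StGen i j _ a) := x in
  fun k l => if k == i then M i l + (if b then - a else a) * M j l else M k l.

Definition word_act (u : st_word R) (M : infmx) : infmx := foldr letter_act M u.

Lemma word_act_cat u v M : word_act (u ++ v) M = word_act u (word_act v M).
Proof. by rewrite /word_act foldr_cat. Qed.

Lemma steinberg_eq_act u v : steinberg_eq u v -> word_act u = word_act v.
Proof.
elim=> {u v} //.
- by move=> u v w _ -> _ ->.
- by move=> u u' v v' _ eu _ ev; apply/funext=> M; rewrite !word_act_cat eu ev.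
- move=> b [i j ij a]; apply/funext=> M; apply/funext=> k; apply/funext=> l /=.
  have ji : (j == i) = false by rewrite eq_sym (negPf ij).
  rewrite ji eqxx; case: eqP => [->|//].
  by case: b => /=; ring.
- move=> i j ij a b; apply/funext=> M; apply/funext=> k; apply/funext=> l /=.
  have ji : (j == i) = false by rewrite eq_sym (negPf ij).
  by rewrite ji eqxx; case: eqP => // _; ring.
- move=> i j k l ij kl a b jk il.
  apply/funext=> M; apply/funext=> r; apply/funext=> c /=.
  have [ji lk li] : [/\ (j == i) = false, (l == k) = false & (l == i) = false].
    by split; rewrite eq_sym; apply: negbTE.
  rewrite ?(eqxx, negPf jk, ji, lk, li).
  have [ik|ik] := eqVneq i k; last first.
    have ki : (k == i) = false by rewrite eq_sym (negPf ik).
    rewrite ?(eqxx, ki, negPf jk, ji, lk, li).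
    have [e|ri] := eqVneq r i; first by rewrite ?(e, eqxx, negPf ik); ring.
    by have [e|//] := eqVneq r k; rewrite ?e; ring.
  move: jk lk; rewrite -ik => jk lk; rewrite ?(eqxx, ji, li).
  by have [e|//] := eqVneq r i; rewrite ?e; ring.
- move=> i j k ij jk ik a b.
  apply/funext=> M; apply/funext=> r; apply/funext=> c /=.
  have [ji kj ki] : [/\ (j == i) = false, (k == j) = false & (k == i) = false].
    by split; rewrite eq_sym; apply: negbTE.
  rewrite ?(eqxx, negPf ij, negPf jk, ji, kj, ki).
  have [e|ri] := eqVneq r i.
    by rewrite ?(e, eqxx, negPf ij, negPf jk, ji, kj, ki); ring.
  by have [e|//] := eqVneq r j; rewrite ?e; ring.
Qed.

(* The canonical homomorphism from St to GL, the matrix St_mx x being the image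
   of x: the generator x_ij(a) is sent to the elementary matrix e_ij(a). *)
Definition St_act (x : St) : infmx -> infmx := word_act (repr x).
Definition St_mx (x : St) : infmx := St_act x infmx1.

Lemma St_act_pi u : St_act (\pi_St u) = word_act u.
Proof. exact/steinberg_eq_act/St_repr. Qed.

Lemma St_act1 : St_act 1%g = id.
Proof. exact: St_act_pi. Qed.

Lemma St_actM x y : St_act (x * y)%g = St_act x \o St_act y.
Proof.
rewrite -[x]reprK -[y]reprK St_mulE !St_act_pi.
by apply/funext=> M; rewrite word_act_cat.
Qed.

Definition in_K2 : {pred St} := fun x => `[< St_mx x = infmx1 >].

Lemma in_K2P x : reflect (St_mx x = infmx1) (x \in in_K2).
Proof. exact: asboolP. Qed.

Lemma group_closed_K2 : group_closed in_K2.
Proof.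
split; first by apply/in_K2P; rewrite /St_mx St_act1.
move=> x y /in_K2P x1 /in_K2P y1; apply/in_K2P.
rewrite /St_mx in x1 y1 *; rewrite -[in LHS]y1 -[LHS]/((St_act _ \o St_act y) _).
by rewrite -St_actM divgK.
Qed.

Definition K2 := {x : St | x \in in_K2}.

HB.instance Definition _ := SubChoice.on K2.
HB.instance Definition _ :=
  SubChoice_isSubGroup.Build St in_K2 K2 group_closed_K2.

End Steinberg.

Section Functoriality.
Variables (R S : comNzRingType) (f : {rmorphism R -> S}).

Definition letter_map (x : bool * st_gen R) : bool * st_gen S :=
  let: (b, StGen _ _ ij a) := x in (b, StGen ij (f a)).

Definition word_map (u : st_word R) : st_word S := map letter_map u.

Definition infmx_map (M : infmx R) : infmx S := fun k l => f (M k l).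

Lemma word_map_eq u v :
  steinberg_eq u v -> steinberg_eq (word_map u) (word_map v).
Proof.
elim=> {u v} [u|u v _ IH|u v w _ IHu _ IHv|u u' v v' _ IHu _ IHv|b []|||].
- exact: StRefl.
- exact: StSym.
- exact: StTrans IHu IHv.
- by rewrite /word_map !map_cat; exact: StCat.
- by move=> *; exact: StCancel.
- by move=> *; rewrite /= rmorphD; exact: StAdd.
- by move=> *; exact: StComm.
- by move=> *; rewrite /= rmorphM; exact: StMul.
Qed.

Definition St_map (x : St R) : St S := \pi_(St S) (word_map (repr x)).

Lemma St_map_pi u : St_map (\pi_(St R) u) = \pi_(St S) (word_map u).
Proof. by apply/eqP/St_eqP/word_map_eq/St_repr. Qed.

Lemma St_mapM : {morph St_map : x y / (x * y)%g}.
Proof.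
move=> x y; rewrite -[x]reprK -[y]reprK St_mulE !St_map_pi St_mulE.
by rewrite /word_map map_cat.
Qed.

Lemma word_act_map u M :
  word_act (word_map u) (infmx_map M) = infmx_map (word_act u M).
Proof.
elim: u => [//|[b [i j ij a]] u IHu]; rewrite /= {}IHu.
apply/funext=> k; apply/funext=> l; rewrite /infmx_map.
by case: b; case: ifP => // _; rewrite rmorphD rmorphM ?rmorphN.
Qed.

Lemma St_mx_map x : St_mx (St_map x) = infmx_map (St_mx x).
Proof.
rewrite /St_mx St_act_pi /St_act -word_act_map; congr word_act.
by apply/funext=> k; apply/funext=> l; rewrite /infmx_map rmorph_nat.
Qed.

Lemma St_map_K2 (x : K2 R) : St_map (val x) \in @in_K2 S.
Proof.
apply/in_K2P; rewrite St_mx_map (in_K2P _ (valP x)).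
by apply/funext=> k; apply/funext=> l; rewrite /infmx_map rmorph_nat.
Qed.

Definition K2_map (x : K2 R) : K2 S := Sub (St_map (val x)) (St_map_K2 x).

Lemma K2_mapF : {morph K2_map : x y / (x / y)%g}.
Proof.
have mapM (x y : K2 R) : K2_map (x * y)%g = (K2_map x * K2_map y)%g.
  by apply: val_inj; rewrite /= St_mapM.
by move=> x y; apply: (mulIg (K2_map y)); rewrite -mapM !divgK.
Qed.

HB.instance Definition _ := isGroupMorphism.Build (K2 R) (K2 S) K2_map K2_mapF.

End Functoriality.

(* Main.v *)
(* Write O for the integral closure of A in F, J for its Jacobson radical and k
   for the residue field, and suppose that the maximal ideal m of A needs at
   least two generators x, y. The symbol {1 - x, 1 - y} in K2(A), multiplied by an
   element on which a suitable invariant of K2(A) vanishes, dies in K2(F), while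
   the invariant of {1 - x, 1 - y} is 1.

   Since k is perfect, taking coordinates along x and y in m / m^2, relative to
   the p-th powers, gives two derivations d1, d2 : A -> k over the residue map. The
   2-cocycle tr(g^-1 d1(g) d2(h) h^-1) extends the elementary group centrally and
   defines a function on the Steinberg group of A; it takes the value
   d1(x) d2(y) = 1 at {1 - x, 1 - y} and vanishes on words with coefficients in the
   subring ker d2.

   So it suffices that {1 - x, 1 - y} becomes, in K2(F), the image of a word with
   coefficients in ker d2. Deep symbols {1 - z, v}, with z in a high power of the
   conductor, are such images by the Dennis-Stein relations, which only involve
   elements of the conductor. The other symbols {1 - z, v}, z in J, v a unit of O,
   are reduced to these by descending induction on the J-adic order of z: J = t O is
   principal, and modulo J every element of O is a p^M-th power e^q, so that z may be
   replaced by e^q t^n. Then {1 - e^q t^n, e^q t^n} = 1 and q {1 - z, e} =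
   {1 - z^q, e} is deep. *)

Require Import Defs.
From HB Require Import structures.
From mathcomp Require Import all_boot all_order all_algebra all_field.
From mathcomp Require Import ring boolp.

Set Implicit Arguments.
Unset Strict Implicit.
Unset Printing Implicit Defensive.

Import GRing.Theory.
Local Open Scope ring_scope.
Local Open Scope quotient_scope.

(** * Derivations over a ring map, Frobenius and powers of integral elements *)

Section Derivation.
Variables (A k : comNzRingType) (pi : {rmorphism A -> k}) (d : A -> k).
Hypothesis dD : {morph d : a b / a + b}.
Hypothesis dM : forall a b, d (a * b) = pi a * d b + d a * pi b.

Lemma derivation0 : d 0 = 0.
Proof. by apply: (addrI (d 0)); rewrite -dD !addr0. Qed.

Lemma derivation1 : d 1 = 0.
Proof.
apply: (addrI (d 1)).
by rewrite -{3}[1]mulr1 dM rmorph1 mul1r mulr1 addr0.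
Qed.

Lemma derivationN a : d (- a) = - d a.
Proof. by apply: (addrI (d a)); rewrite -dD !subrr derivation0. Qed.

Lemma derivation_inv a b : a * b = 1 -> d a = 0 -> d b = 0.
Proof.
move=> ab da; have E : pi a * d b = 0.
  by rewrite -derivation1 -ab dM da mul0r addr0.
by rewrite -[d b]mul1r -(rmorph1 pi) -ab mulrC rmorphM mulrCA mulrA E mul0r.
Qed.

End Derivation.

Lemma frobeniusD (R : comNzRingType) p n (x y : R) : p \in [pchar R] ->
  (x + y) ^+ (p ^ n) = x ^+ (p ^ n) + y ^+ (p ^ n).
Proof.
move=> charR; apply: exprDn_pchar.
by rewrite pnatX pnatE ?charR // (pcharf_prime charR).
Qed.

Lemma integral_exp (A : comNzRingType) (F : comUnitRingType)
    (iota : {rmorphism A -> F}) n y :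
  integralOver iota y -> integralOver iota (y ^+ n).
Proof.
move=> Oy; elim: n => [|n IHn]; first exact: integral1.
by rewrite exprS; exact: integral_mul.
Qed.

(** * Symbols in the Steinberg group *)

Section SteinbergGenerators.
Variable R : comNzRingType.
Implicit Types (i j k l : nat) (a b c : R).

(* Off-diagonal indices only: the diagonal value is a junk 1. *)
Definition stx i j a : St R :=
  if @idP (i != j) is ReflectT ij then \pi_(St R) [:: x_ ij a] else 1%g.
Arguments stx i j a%_R.

Lemma stxE i j (ij : i != j) a : stx i j a = \pi_(St R) [:: x_ ij a].
Proof.
rewrite /stx; case: {-}_ / idP => [ij'|]; last by rewrite ij.
by rewrite (bool_irrelevance ij' ij).
Qed.

Lemma stxVE i j (ij : i != j) a : (stx i j a)^-1%g = \pi_(St R) [:: xV_ ij a].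
Proof.
rewrite stxE //; apply: mulg1_eq.
by rewrite St_mulE; apply/eqP/St_eqP; exact: StCancel.
Qed.

Lemma stxD i j a b : i != j -> (stx i j a * stx i j b)%g = stx i j (a + b).
Proof.
move=> ij; rewrite !(stxE ij) St_mulE.
by apply/eqP/St_eqP; exact: StAdd.
Qed.

Lemma stx0 i j : i != j -> stx i j 0 = 1%g.
Proof. by move=> ij; apply: (mulgI (stx i j 0));
  rewrite stxD // addr0 mulg1. Qed.

Lemma stxN i j a : i != j -> stx i j (- a) = (stx i j a)^-1%g.
Proof.
by move=> ij; apply/esym/mulg1_eq; rewrite stxD // subrr stx0.
Qed.

Lemma St_mul4 (x y z t : bool * st_gen R) :
  (\pi_(St R) [:: x] * \pi_(St R) [:: y] * \pi_(St R) [:: z] *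
   \pi_(St R) [:: t])%g = \pi_(St R) [:: x; y; z; t].
Proof.
by rewrite (St_mulE [:: x]) (St_mulE [:: x; y]) (St_mulE [:: x; y; z]).
Qed.

Lemma stx_commute i j k l a b :
  i != j -> k != l -> j != k -> i != l -> commute (stx i j a) (stx k l b).
Proof.
move=> ij kl jk il; apply: divg1_eq; rewrite invgM mulgA !stxVE // !stxE //.
rewrite St_mul4; apply/eqP/St_eqP; exact: StComm.
Qed.

Lemma stx_conj_fix i j k l a b :
  i != j -> k != l -> j != k -> i != l -> (stx k l b ^ stx i j a)%g = stx k l b.
Proof.
by move=> ij kl jk il; rewrite conjgE -(stx_commute _ _ ij kl jk il) mulKg.
Qed.

Lemma stx_mul i j k a b : i != j -> j != k -> i != k ->
  (stx i j a * stx j k b * (stx i j a)^-1 * (stx j k b)^-1)%g = stx i k (a * b).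
Proof.
move=> ij jk ik; rewrite !stxVE // !stxE // St_mul4.
by apply/eqP/St_eqP; exact: StMul.
Qed.

(** [StMul] uses x y x^-1 y^-1, whereas [[~ x, y]] is x^-1 y^-1 x y. Negating both coefficients
    passes from one to the other and preserves their product. *)
Lemma stx_commg i j k a b : i != j -> j != k -> i != k ->
  [~ stx i j a, stx j k b]%g = stx i k (a * b).
Proof.
move=> ij jk ik; rewrite -[(a * b)%R]mulrNN -(@stx_mul i j k) // !stxN //.
by rewrite /commg /conjg !gsimp !mulgA.
Qed.

Lemma stx_conjl i j k a b : i != j -> j != k -> i != k ->
  (stx j k b ^ stx i j a = stx i k (- (a * b)) * stx j k b)%g.
Proof.
move=> ij jk ik; rewrite -mulrN -(@stx_commg i j k) // stxN //.
by rewrite commgEr invgK mulgVK.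
Qed.

Lemma stx_conjr i j k a b : i != j -> k != i -> k != j ->
  (stx k i b ^ stx i j a = stx k j (b * a) * stx k i b)%g.
Proof.
move=> ij ki kj.
have -> : commute (stx k j (b * a)) (stx k i b).
  by apply: stx_commute; rewrite // eq_sym.
by rewrite -(@stx_commg k i j) // commgEl mulVKg.
Qed.

End SteinbergGenerators.
Arguments stx {R} i j a%_R.

(** * Weyl elements, Steinberg symbols and the Dennis-Stein formula *)

Section SteinbergWeyl.
Local Open Scope group_scope.
Variable R : comUnitRingType.
Implicit Types (i j k l : nat) (a b c u v : R).

(** The usual w_ij(u) and h_ij(u): in rows and columns i, j their matrices are antidiagonal with
    entries u, -u^-1 and diagonal with entries u, u^-1. *)
Definition stw i j u : St R := stx i j u * stx j i (- u^-1) * stx i j u.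
Arguments stw i j u%_R.
Definition sth i j u : St R := stw i j u * stw i j (- 1).
Arguments sth i j u%_R.

Section ThreeIndices.
Variables i j k : nat.
Hypotheses (ij : i != j) (ik : i != k) (jk : j != k).
Let ji : j != i. Proof. by rewrite eq_sym. Qed.
Let ki : k != i. Proof. by rewrite eq_sym. Qed.
Let kj : k != j. Proof. by rewrite eq_sym. Qed.

(* Instantiated so that rewriting cannot unfold the conjugation. *)
Let conjXX i1 j1 i2 j2 i3 j3 a b c :
  (stx i1 j1 a * stx i2 j2 b) ^ stx i3 j3 c =
    stx i1 j1 a ^ stx i3 j3 c * stx i2 j2 b ^ stx i3 j3 c := conjMg _ _ _.

Lemma stw_conj_jk u c : u \is a GRing.unit ->
  stx j k c ^ stw i j u = stx i k (- (u * c)).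
Proof.
move=> Uu; rewrite /stw !conjgM stx_conjl // conjXX.
rewrite (@stx_conjl _ j i k) // (@stx_conj_fix _ j i j k) //.
rewrite mulrNN mulKr // -mulgA [_ * stx j k c](stx_commute _ _ ik) // mulgA.
by rewrite stxD // addNr stx0 // mul1g stx_conj_fix.
Qed.

Lemma stw_conj_ik u c : u \is a GRing.unit ->
  stx i k c ^ stw i j u = stx j k (u^-1 * c).
Proof.
move=> Uu; rewrite /stw !conjgM (@stx_conj_fix _ i j i k) //.
rewrite (@stx_conjl _ j i k) // conjXX.
rewrite (@stx_conj_fix _ i j i k) // stx_conjl // mulNr opprK mulVKr //.
by rewrite [stx i k _ * stx j k _](stx_commute _ _ ik) // -mulgA stxD // addNr
  stx0 // mulg1.
Qed.

Lemma stw_conj_ki u c : u \is a GRing.unit ->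
  stx k i c ^ stw i j u = stx k j (c * u).
Proof.
move=> Uu; rewrite /stw !conjgM stx_conjr // conjXX.
rewrite (@stx_conjr _ j i k) // (@stx_conj_fix _ j i k i) //.
rewrite mulrN mulrK // -mulgA [_ * stx k i c](stx_commute _ _ kj) // mulgA.
by rewrite stxD // addNr stx0 // mul1g stx_conj_fix.
Qed.

Lemma stw_conj_kj u c : u \is a GRing.unit ->
  stx k j c ^ stw i j u = stx k i (- (c * u^-1)).
Proof.
move=> Uu; rewrite /stw !conjgM (@stx_conj_fix _ i j k j) //.
rewrite (@stx_conjr _ j i k) // conjXX.
rewrite (@stx_conj_fix _ i j k j) // stx_conjr // mulrN mulNr mulrVK //.
by rewrite [stx k j _ * stx k i _](stx_commute _ _ kj) // -mulgA stxD // addNr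
  stx0 // mulg1.
Qed.

(** Written as a commutator through the third index k, the generator falls under the cases already
    computed. *)
Lemma stw_conj_ij u c : u \is a GRing.unit ->
  stx i j c ^ stw i j u = stx j i (- (u^-1 * c * u^-1)).
Proof.
move=> Uu; rewrite -{1}[c]mulr1 -(@stx_commg _ i k j) // conjRg.
rewrite stw_conj_ik // stw_conj_kj // mul1r stx_commg //.
by rewrite mulrN.
Qed.

Lemma stw_conj_ji u c : u \is a GRing.unit ->
  stx j i c ^ stw i j u = stx i j (- (u * c * u)).
Proof.
move=> Uu; rewrite -{1}[c]mulr1 -(@stx_commg _ j k i) // conjRg.
rewrite stw_conj_jk // stw_conj_ki // mul1r stx_commg //.
by rewrite mulNr.
Qed.

(** An element is fixed by conjugation by itself; conjugating its three factors one by one yields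
    the other expression. *)
Lemma stw_sym u : u \is a GRing.unit -> stw i j u = stw j i (- u^-1).
Proof.
move=> Uu; have: stw i j u ^ stw i j u = stw i j u by rewrite conjgE mulKg.
rewrite {1}/stw !conjMg stw_conj_ij // stw_conj_ji // => <-.
by rewrite /stw invrN invrK !opprK mulVr // mul1r mulrN mulNr mulrV // opprK
  mul1r.
Qed.

Lemma stwV u : u \is a GRing.unit -> (stw i j u)^-1 = stw i j (- u).
Proof.
by move=> Uu; rewrite /stw !invgM -!stxN // invrN opprK mulgA.
Qed.

End ThreeIndices.

Lemma stx_central (z : St R) :
    (forall i j a, i != j -> commute (stx i j a) z) -> forall g, commute g z.
Proof.
move=> cz g; rewrite -[g]reprK; elim: (repr g) => [|[b [i j ij a]] w IHw].
  exact/commute_sym/commute1.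
rewrite -cat1s -St_mulE; apply/commute_sym/commuteM; last exact/commute_sym.
apply/commute_sym; case: b => //=.
  rewrite -/(xV_ ij a) -stxVE.
  exact/commute_sym/commuteV/commute_sym/cz.
by rewrite -/(x_ ij a) -stxE; exact: cz.
Qed.

(** The p-th diagonal entry of the inverse of h_ij(u); the inverse appears because [x ^ y] is y^-1 x
    y. *)
Definition row_weight (i j p : nat) u : R :=
  (if p == i then u^-1 else if p == j then u else 1)%R.

Lemma row_weight_unit i j p u :
  u \is a GRing.unit -> row_weight i j p u \is a GRing.unit.
Proof. by rewrite /row_weight; do 2?case: ifP => // _;
  rewrite ?unitrV ?unitr1. Qed.

Lemma row_weightM i j p u v : u \is a GRing.unit -> v \is a GRing.unit ->
  row_weight i j p (u * v) = (row_weight i j p u * row_weight i j p v)%R.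
Proof.
rewrite /row_weight => Uu Uv.
by do 2?case: ifP => // _; rewrite ?mulr1 // invrM // mulrC.
Qed.

Lemma sth_conj i j p q u c : i != j -> p != q -> u \is a GRing.unit ->
  stx p q c ^ sth i j u =
    stx p q (row_weight i j p u / row_weight i j q u * c)%R.
Proof.
move=> ij pq Uu; have UN1 := unitrN1 R; have invN1 := invrN1 R.
have ji : j != i by rewrite eq_sym.
rewrite /sth /row_weight conjgM.
have [pi|pi] := eqVneq p i.
  rewrite {p}pi in pq *; have qi :
    (q == i) = false by rewrite eq_sym (negPf pq).
  rewrite qi; have [qj|qj] := eqVneq q j; last first.
    rewrite stw_conj_ik // 1?eq_sym // stw_conj_jk // 1?eq_sym //.
    by rewrite invr1 mulr1 mulN1r opprK.
  (* In the stable group an index different from i and j is always at hand. *)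
  rewrite {q}qj in pq qi *; pose k := (i + j).+1.
  have ik : i != k by rewrite neq_ltn /k ltnS leq_addr.
  have jk : j != k by rewrite neq_ltn /k ltnS leq_addl.
  rewrite (@stw_conj_ij _ _ k) // (@stw_conj_ji _ _ k) //.
  by rewrite !(mulN1r, mulrN1, mulNr, mulrN, opprK) mulrAC.
have [pj|pj] := eqVneq p j.
  rewrite {p}pj in pq pi *; have qj :
    (q == j) = false by rewrite eq_sym (negPf pq).
  rewrite qj; have [qi|qi] := eqVneq q i; last first.
    rewrite stw_conj_jk // 1?eq_sym // stw_conj_ik // 1?eq_sym //.
    by rewrite invN1 invr1 mulr1 mulN1r opprK.
  rewrite {q}qi in pq qj *; pose k := (i + j).+1.
  have ik : i != k by rewrite neq_ltn /k ltnS leq_addr.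
  have jk : j != k by rewrite neq_ltn /k ltnS leq_addl.
  rewrite (@stw_conj_ji _ _ k) // (@stw_conj_ij _ _ k) //.
  by rewrite invN1 !(mulN1r, mulrN1, mulNr, mulrN, opprK) invrK mulrAC.
have [qi|qi] := eqVneq q i.
  rewrite {q}qi in pq *; rewrite stw_conj_ki // 1?eq_sym //.
  rewrite stw_conj_kj // 1?eq_sym // invN1 mulrN1 opprK invrK mul1r.
  by rewrite mulrC.
have [qj|qj] := eqVneq q j.
  rewrite {q}qj in pq qi *; rewrite stw_conj_kj // 1?eq_sym //.
  rewrite stw_conj_ki // 1?eq_sym // mulrN1 opprK mul1r.
  by rewrite mulrC.
rewrite divr1 mul1r /stw !conjgM !stx_conj_fix //; by rewrite eq_sym.
Qed.

Section Symbols.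
Variables i j : nat.
Hypothesis ij : i != j.

Let k := (i + j).+1.
Let ik : i != k. Proof. by rewrite neq_ltn /k ltnS leq_addr. Qed.
Let jk : j != k. Proof. by rewrite neq_ltn /k ltnS leq_addl. Qed.
Let ji : j != i. Proof. by rewrite eq_sym. Qed.
Let ki : k != i. Proof. by rewrite eq_sym. Qed.

(** The Steinberg symbol {u, v}: the failure of h_ij to be multiplicative. *)
Definition symbol u v : St R :=
  sth i j (u * v) * (sth i j u)^-1 * (sth i j v)^-1.

Arguments symbol u%_R v%_R.

(** Each h scales every generator by a factor multiplicative in its argument, so the three scalings
    cancel. *)
Lemma symbol_central u v g : u \is a GRing.unit -> v \is a GRing.unit ->
  commute g (symbol u v).
Proof.
move=> Uu Uv; apply: stx_central => p q a pq.
have conjV x b : x \is a GRing.unit -> stx p q b ^ (sth i j x)^-1 =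
    stx p q ((row_weight i j p x / row_weight i j q x)^-1 * b)%R.
  move=> Ux; apply/(canLR (conjgK _)); rewrite sth_conj // mulVKr //.
  by rewrite unitrM unitrV !row_weight_unit.
apply/commgP; rewrite -conjg_fix /symbol 2!conjgM sth_conj ?unitrM ?Uu //.
rewrite !conjV // !row_weightM //; apply/eqP; congr stx.
have := row_weight_unit i j p Uu; have := row_weight_unit i j q Uu.
have := row_weight_unit i j p Uv; have := row_weight_unit i j q Uv.
move: (row_weight i j p u) (row_weight i j p v) => pu pv.
move: (row_weight i j q u) (row_weight i j q v) => qu qv Uqv Upv Uqu Upu.
rewrite !invrM ?unitrV // !invrK.
transitivity (qv * qv^-1 * (qu * qu^-1) * (pv * pv^-1) * (pu * pu^-1) * a)%R.
  by ring.
by rewrite !mulrV // !mul1r.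
Qed.

Lemma sthM u v :
  sth i j (u * v) = symbol u v * (sth i j v * sth i j u).
Proof. rewrite /symbol; move: (sth i j u) (sth i j v) (sth i j _) => x y z.
by rewrite -!mulgA mulKg mulVg mulg1. Qed.

Lemma sthV u : u \is a GRing.unit -> (sth i j u)^-1 = stw i j 1 * stw i j (- u).
Proof.
by move=> Uu; rewrite /sth invgM !stwV ?unitrN1 // opprK.
Qed.

(** Conjugation by h_ik(u^-1) carries w_ij(x) to w_ij(u x). Since conjugation is a homomorphism,
    bimultiplicativity of symbols will follow from this formula. *)
Lemma sth_conj_symbol u v : u \is a GRing.unit -> v \is a GRing.unit ->
  sth i j v ^ sth i k u^-1 = symbol u v * sth i j v.
Proof.
move=> Uu Uv; rewrite /symbol mulgVK.
have conjw x : x \is a GRing.unit ->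
    stw i j x ^ sth i k u^-1 = stw i j (u * x).
  move=> Ux; rewrite /stw !conjMg !sth_conj ?unitrV //.
  rewrite /row_weight !eqxx (negPf ji) (negPf jk) !(invrK, invr1, mulr1, mul1r).
  by congr (_ * stx _ _ _ * _); rewrite invrM // mulrN mulrC.
have w1V : stw i j 1 = (stw i j (- 1))^-1 by rewrite stwV ?unitrN1 // opprK.
rewrite {1}/sth conjMg !conjw ?unitrN1 // sthV // w1V mulrN1 /sth.
by rewrite -(mulgA (stw i j (u * v))) mulVKg.
Qed.

Lemma symbolMr u v v' :
    u \is a GRing.unit -> v \is a GRing.unit -> v' \is a GRing.unit ->
  symbol u (v * v') = symbol u v * symbol u v'.
Proof.
move=> Uu Uv Uv'; apply: (mulIg (sth i j (v * v'))).
rewrite -sth_conj_symbol ?unitrM ?Uv // sthM conjMg.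
rewrite [_ ^ _](_ : _ = symbol v v'); last first.
  by apply/eqP; rewrite conjg_fix; apply/commgP/commute_sym/symbol_central.
rewrite conjMg !sth_conj_symbol //.
have slide w w' x y : w \is a GRing.unit -> w' \is a GRing.unit ->
    x * (symbol w w' * y) = symbol w w' * (x * y).
  by move=> Uw Uw'; rewrite mulgA (symbol_central x) // mulgA.
have := slide _ _ _ _ Uu Uv; have := slide _ _ _ _ Uu Uv'.
move: (symbol u v) (symbol u v') (symbol v v') (sth i j v) (sth i j v').
by move=> e d c h h' sd se; rewrite -!mulgA !se !(sd c).
Qed.

Lemma stw_conj_stw u v : u \is a GRing.unit -> v \is a GRing.unit ->
  stw i j v ^ stw i j u = stw i j (u ^+ 2 / v).
Proof.
move=> Uu Uv; have Ux : (u ^+ 2 / v)%R \is a GRing.unit.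
  by rewrite unitrM unitrX ?unitrV.
rewrite (stw_sym ij ik jk Ux).
rewrite {1}/stw !conjMg (stw_conj_ij ij ik jk) // (stw_conj_ji ij ik jk) //.
have -> : ((u ^+ 2 / v)^-1 = u^-1 * v * u^-1)%R.
  by rewrite invrM ?unitrX ?unitrV // invrK -exprVn; ring.
rewrite /stw invrN !opprK; congr (_ * stx _ _ _ * _).
by rewrite !invrM ?unitrM ?unitrV ?Uu // !invrK; ring.
Qed.

(** Conjugating w(-1) by w(-u) gives w(-u^2), whence h(u) h(-u) = h(-u^2). *)
Lemma symbol_opp u : u \is a GRing.unit -> symbol u (- u) = 1.
Proof.
have sthN v : v \is a GRing.unit ->
  sth i j v * sth i j (- v) = sth i j (v * - v).
  move=> Uv; have UN : (- v)%R \is a GRing.unit by rewrite unitrN.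
  have := stw_conj_stw UN (unitrN1 R); rewrite invrN1 mulrN1 sqrrN.
  rewrite mulrN -expr2 /sth => <-; rewrite conjgE stwV // opprK.
  by move: (stw i j v) (stw i j (- 1)) (stw i j (- v)) => a b c;
    rewrite -!mulgA.
move=> Uu; rewrite /symbol -mulgA -invgM [(u * _)%R]mulrC.
have := sthN (- u)%R; rewrite unitrN opprK => /(_ Uu) <-.
exact: mulgV.
Qed.

Lemma symbol_Steinberg u : u \is a GRing.unit -> 1 - u \is a GRing.unit ->
  symbol (1 - u) u = 1.
Proof.
move=> Uu Uv; set v := (1 - u)%R in Uv *.
(* With w_ij(-1) = w_ji(1), the outer factors x_ji(1) are moved past w(u) and w(v); the middle then
   collapses because u - 1 + v = 0. *)
have wM : stw i j u * stw i j (- 1) * stw i j v = stw i j (u * v).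
  rewrite (stw_sym ij ik jk (unitrN1 R)) invrN1 opprK.
  have x1 : stw i j u * stx j i 1 = stx i j (- (u * u)) * stw i j u.
    have := stw_conj_ji ij ik jk 1 (_ : (- u)%R \is a GRing.unit).
    rewrite unitrN => /(_ Uu); rewrite mulr1 mulrNN => <-.
    rewrite conjgE -stwV //.
    by move: (stw i j u) (stx j i 1) => x y; rewrite !gnorm.
  have x2 : stx j i 1 * stw i j v = stw i j v * stx i j (- (v * v)).
    by have := stw_conj_ji ij ik jk 1 Uv; rewrite mulr1 => <-;
      rewrite conjgE mulVKg.
  have N1 : stw j i 1 = stx j i 1 * stx i j (-1) * stx j i 1 by rewrite /stw
    invr1.
  rewrite N1.
  transitivity ((stw i j u * stx j i 1) * stx i j (-1) * (stx j i 1 * stw i j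
    v)).
    by rewrite !mulgA.
  rewrite x1 x2 {1 2}/stw.
  transitivity (stx i j (- (u * u)) * stx i j u * stx j i (- u^-1) *
     (stx i j u * stx i j (- 1) * stx i j v) * stx j i (- v^-1) *
     (stx i j v * stx i j (- (v * v)))).
    by rewrite !mulgA.
  rewrite !stxD // [(u + -1 + v)%R](_ : _ = 0) ?stx0 // ?mulg1;
    last by rewrite /v; ring.
  rewrite -(mulgA (stx i j _) (stx j i _)) stxD // /stw.
  congr (stx _ _ _ * stx _ _ _ * stx _ _ _).
  - by rewrite /v; ring.
  - rewrite invrM // -opprD; congr (- _)%R.
    apply: (mulrI Uu); apply: (mulrI Uv).
    transitivity ((u * u^-1) * v + (v * v^-1) * u)%R; first by ring.
    transitivity ((u * u^-1) * (v * v^-1))%R; last by ring.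
    by rewrite !mulrV // /v; ring.
  - by rewrite /v; ring.
rewrite /symbol -mulgA -invgM [(v * u)%R]mulrC.
suff -> : sth i j u * sth i j v = sth i j (u * v) by exact: mulgV.
by rewrite /sth -wM !mulgA.
Qed.

End Symbols.
Arguments symbol i j u%_R v%_R.

Section SymbolRules.
Variables i j : nat.
Hypothesis ij : i != j.

Let k := (i + j).+1.
Let ik : i != k. Proof. by rewrite neq_ltn /k ltnS leq_addr. Qed.

(** The elements h_ik(u^-1) multiply up to a central symbol, which conjugates trivially, so their
    conjugations compose. *)
Lemma symbolMl u u' v :
    u \is a GRing.unit -> u' \is a GRing.unit -> v \is a GRing.unit ->
  symbol i j (u * u') v = symbol i j u v * symbol i j u' v.
Proof.
move=> Uu Uu' Uv; apply: (mulIg (sth i j v)).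
rewrite -sth_conj_symbol ?unitrM ?Uu // invrM // sthM.
have fix_symbol w w' x : w \is a GRing.unit -> w' \is a GRing.unit ->
    x ^ symbol i k w w' = x.
  by move=> Uw Uw'; apply/conjg_fixP/commgP/(symbol_central ik).
rewrite (conjgM _ (symbol _ _ _ _)) (conjgM _ (sth _ _ _)).
rewrite fix_symbol ?unitrV // !sth_conj_symbol // conjMg sth_conj_symbol //.
have -> : symbol i j u v ^ sth i k u'^-1 = symbol i j u v.
  by apply/conjg_fixP/commgP/commute_sym/(symbol_central ij).
by rewrite mulgA.
Qed.

(** Expand {u v, -u v} = 1 by bimultiplicativity and cancel {u, -u} and {v, -v}. *)
Lemma symbolC u v : u \is a GRing.unit -> v \is a GRing.unit ->
  symbol i j v u = (symbol i j u v)^-1.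
Proof.
move=> Uu Uv; have UuN : (- u)%R \is a GRing.unit by rewrite unitrN.
have UvN : (- v)%R \is a GRing.unit by rewrite unitrN.
have := symbol_opp ij (_ : (u * v)%R \is a GRing.unit).
rewrite unitrM Uu Uv => /(_ isT); rewrite symbolMl ?unitrN ?unitrM ?Uu //.
rewrite -{1}mulNr symbolMr // symbol_opp // mul1g -mulrN symbolMr //.
by rewrite symbol_opp // mulg1 => /mulg1_eq.
Qed.

Lemma symbolXl u v n : u \is a GRing.unit -> v \is a GRing.unit ->
  symbol i j (u ^+ n) v = symbol i j u v ^+ n.
Proof.
move=> Uu Uv; elim: n => [|n IHn].
  apply: (mulgI (symbol i j 1 v)).
  by rewrite expr0 -symbolMl ?unitr1 // mulr1 expg0 mulg1.
by rewrite exprS symbolMl ?unitrX // IHn expgS.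
Qed.

Lemma symbolXr u v n : u \is a GRing.unit -> v \is a GRing.unit ->
  symbol i j u (v ^+ n) = symbol i j u v ^+ n.
Proof.
move=> Uu Uv; rewrite symbolC ?unitrX // symbolXl // symbolC //.
by rewrite expVgn invgK.
Qed.

(* The right-hand side does not involve the inverse of b: it is the Dennis-Stein
   symbol, which is defined over any subring containing a, b and the inverse of
   1 - a * b. *)
Lemma symbol_Dennis_Stein a b u :
    u \is a GRing.unit -> b \is a GRing.unit -> u = (1 - a * b)%R ->
  symbol i j u b =
    stx j i a * stx i j (- b) * stx j i (- (a / u)) * stx i j (u * b) *
      stw i j (- u) * stw i j 1.
Proof.
move=> Uu Ub Eu; have ik' := ik.
have ji : j != i by rewrite eq_sym.
have jk : j != k by rewrite neq_ltn /k ltnS leq_addl.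
have UbN : (- b)%R \is a GRing.unit by rewrite unitrN.
have Eb : stw i j (- b) = stx i j (- b) * stx j i b^-1 * stx i j (- b).
  by rewrite /stw invrN opprK.
have E1 : symbol i j u b = stw i j (u * b) * stw i j (- u) * stw i j 1 * stw i
  j (- b).
  rewrite /symbol !(sthV ij) // /sth.
  have -> : stw i j (-1) = (stw i j 1)^-1 by rewrite stwV ?unitr1.
  move: (stw i j (u * b)) (stw i j 1) (stw i j (- u)) (stw i j (- b)) =>
    x y z t.
  by rewrite !gnorm.
(* Centrality allows the last factor of [E1] to be moved to the front. *)
have E2 : symbol i j u b = stw i j (- b) * stw i j (u * b) * stw i j (- u) *
  stw i j 1.
  apply: (mulIg (stw i j (- b))).
  rewrite -(symbol_central ij (stw i j (- b))) // E1.
  by rewrite !mulgA.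
rewrite E2 -!(mulgA _ (stw i j (- u))); congr (_ * _).
(* Here b^-1 disappears: after the splittings below it only occurs in this conjugate. *)
have conj : stx j i b^-1 * stx i j (- (a * b ^+ 2)) * stx j i (- b^-1) =
    stx i j b * stx j i a * stx i j (- b).
  have -> : stx j i b^-1 = stx i j b * stw i j (- b) * stx i j b.
    rewrite Eb; have := stxN b ij; move: (stx i j (- b)) (stx i j b) => x y ->.
    by rewrite !gnorm.
  have -> : stx j i (- b^-1) = stx i j (- b) * stw i j b * stx i j (- b).
    rewrite stxN // -[X in X^-1](_ : stx i j b * stw i j (- b) * stx i j b = _).
      by rewrite (invgM _ (stx i j b)) (invgM (stx i j b)) stwV // opprK -stxN
        // mulgA.
    rewrite Eb; have := stxN b ij; move: (stx i j (- b)) (stx i j b) => x y ->.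
    by rewrite !gnorm.
  have w_conj : stw i j (- b) * stx i j (- (a * b ^+ 2)) * stw i j b = stx j i
    a.
    rewrite -stwV // -mulgA -conjgE (stw_conj_ij ij ik' jk) //; congr stx.
    transitivity ((b^-1 * b) * (b^-1 * b) * a)%R; first by ring.
    by rewrite mulVr // !mul1r.
  have x_conj : stx i j b * stx i j (- (a * b ^+ 2)) * stx i j (- b) = stx i j
    (- (a * b ^+ 2)).
    by rewrite !stxD //; congr stx; ring.
  rewrite -w_conj -[in RHS]x_conj.
  move: (stx i j b) (stx i j (- b)) (stw i j b) (stw i j (- b)) (stx i j (- _)).
  by move=> x y w w' c; rewrite !mulgA.
have u_split : stx j i (- (u * b)^-1) = stx j i (- b^-1) * stx j i (- (a / u)).
  rewrite stxD // invrM //; congr stx; apply: (mulrI Ub).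
  transitivity (- (b / b) * u^-1)%R; first by ring.
  rewrite mulrV //; transitivity (- (b / b) - a * b / u)%R; last by ring.
  rewrite mulrV // [in LHS](_ : u^-1 = 1 + a * b / u)%R; first by ring.
  apply: (mulrI Uu); transitivity (u + a * b * (u / u))%R; last by ring.
  by rewrite mulrV // Eu; ring.
have b_split : stx i j (- b) * stx i j (u * b) = stx i j (- (a * b ^+ 2)).
  by rewrite stxD // Eu; congr stx; ring.
have xN : stx i j (- b) * stx i j b = 1 by rewrite stxN // mulVg.
rewrite Eb /stw u_split.
move: conj b_split xN.
move: (stx i j (- b)) (stx i j b) (stx j i b^-1) (stx j i (- b^-1)).
move: (stx j i (- (a / u))) (stx i j (u * b)) (stx j i a) (stx i j (- _)).
move=> p q r c y x z z' cE yq yx.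
transitivity (y * (z * (y * q) * z') * p * q); first by rewrite !mulgA.
by rewrite yq cE !mulgA yx mul1g.
Qed.
End SymbolRules.
End SteinbergWeyl.

(** * The logarithmic cocycle *)

Section SteinbergCocycle.
Variables (A k : comNzRingType) (pi : {rmorphism A -> k}) (d1 d2 : A -> k).
Hypotheses (d1D : {morph d1 : a b / a + b}) (d2D : {morph d2 : a b / a + b}).
Hypothesis d1M : forall a b, d1 (a * b) = pi a * d1 b + d1 a * pi b.
Hypothesis d2M : forall a b, d2 (a * b) = pi a * d2 b + d2 a * pi b.

(* The logarithmic derivative N = d2(g) g^-1 of a matrix g, read through pi,
   after g is multiplied on the left by the elementary matrix e_ij(a). *)
Definition dlog_step i j (a : A) (N : infmx k) : infmx k := fun r c =>
  N r c + (r == i)%:R * (pi a * N j c)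
    - (c == j)%:R * (pi a * (N r i + (r == i)%:R * (pi a * N j i)))
    + (r == i)%:R * (c == j)%:R * d2 a.

(* The second component is the value at a word of the central extension of the
   elementary group with the 2-cocycle (g, h) |-> tr(g^-1 d1(g) d2(h) h^-1). *)
Definition cocycle_letter (x : bool * st_gen A) (s : infmx k * k) :=
  let: (b, StGen i j _ a) := x in
  let a := if b then - a else a in
  (dlog_step i j a s.1, s.2 + d1 a * s.1 j i).

Definition cocycle_word (w : st_word A) s := foldr cocycle_letter s w.

Lemma cocycle_word_cat u v s :
  cocycle_word (u ++ v) s = cocycle_word u (cocycle_word v s).
Proof. exact: foldr_cat. Qed.

Let d1N := derivationN d1D.
Let d2N := derivationN d2D.
Let d1_1 := derivation1 d1M.
Let d2_1 := derivation1 d2M.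

Let state_eq (N N' : infmx k) (D D' : k) :
  (forall r c, N r c = N' r c) -> D = D' -> (N, D) = (N', D').
Proof. by move=> NN' ->; congr pair; apply/funext=> r; apply/funext=> c. Qed.

Ltac simp_eq := repeat (rewrite ?eqxx; match goal with
  | H : is_true (?x != ?y) |- context [?x == ?y] => rewrite (negPf H)
  | H : is_true (?x != ?y) |- context [?y == ?x] =>
      rewrite [y == x]eq_sym (negPf H) end);
  rewrite ?eqxx ?(mulr1n, mulr0n, mul0r, mul1r).

Ltac split_eq := simp_eq; repeat (match goal with
  | |- context [?x == ?y] => case: (eqVneq x y) => ?; [subst x|] end; simp_eq).

(** The defining relations hold as identities between maps on all pairs (N, D), so the action of
    words descends to the Steinberg group. *)
Lemma steinberg_eq_cocycle u v :
  steinberg_eq u v -> cocycle_word u = cocycle_word v.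
Proof.
elim=> {u v} //.
- by move=> u v w _ -> _ ->.
- move=> u u' v v' _ eu _ ev; apply/funext=> s.
  by rewrite !cocycle_word_cat eu ev.
- move=> b [i j ij a]; apply/funext=> -[N D]; apply: state_eq => [r c|] /=.
    have -> : (if ~~ b then - a else a) = - (if b then - a else a).
      by case: b; rewrite /= ?opprK.
    move: (if b then - a else a) => {}a; rewrite /dlog_step d2N rmorphN.
    by split_eq; ring.
  by rewrite /dlog_step; simp_eq; case: b; rewrite /= ?opprK d1N; ring.
- move=> i j ij a b; apply/funext=> -[N D]; apply: state_eq => [r c|] /=.
    by rewrite /dlog_step d2D rmorphD; split_eq; ring.
  by rewrite /dlog_step d1D; simp_eq; ring.
- move=> i j r s ij rs a b jr i_s; apply/funext=> -[N D].
  apply: state_eq => [m n|] /=.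
    by rewrite /dlog_step !d2N !rmorphN; split_eq; ring.
  by rewrite /dlog_step !d1N !d2N !rmorphN; split_eq; ring.
- move=> i j l ij jl il a b; apply/funext=> -[N D].
  apply: state_eq => [m n|] /=.
    by rewrite /dlog_step d2M !d2N !rmorphN rmorphM; split_eq; ring.
  by rewrite /dlog_step d1M !d1N !d2N !rmorphN; split_eq; ring.
Qed.

Definition horizontal (w : st_word A) := all (fun x => d2 (st_coef x.2) == 0) w.

(** N starts at 0 and stays 0 while the coefficients lie in ker d2, so every increment d1(a) N_ji
    vanishes. *)
Lemma cocycle_horizontal w D : horizontal w ->
  cocycle_word w (fun _ _ => 0, D) = (fun _ _ => 0, D).
Proof.
elim: w => [//|[b [i j ij a]] w IHw] /= /andP[/eqP d2a] /IHw ->.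
apply: state_eq => [r c|] /=; last by ring.
have d2b : d2 (if b then - a else a) = 0 by case: b; rewrite ?d2N d2a ?oppr0.
by rewrite /dlog_step d2b; ring.
Qed.

Definition weyl_word i j (ij : i != j) (ji : j != i) (u u' : A) : st_word A :=
  [:: x_ ij u; x_ ji (- u'); x_ ij u].

(* Spells symbol i j u v, u' and v' being the inverses of u and v. *)
Definition symbol_word i j (ij : i != j) (ji : j != i) (u u' v v' : A) :=
  weyl_word ij ji (u * v) (u' * v') ++ weyl_word ij ji (- u) (- u') ++
  weyl_word ij ji 1 1 ++ weyl_word ij ji (- v) (- v').

Let diag2 i j (p q : k) : infmx k := fun r c =>
  (r == i)%:R * (c == i)%:R * p + (r == j)%:R * (c == j)%:R * q.

(** To first order u' is the inverse of u: as pi u has square 1, inversion only changes the sign of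
    the derivations. Both residues 1 and -1 occur in [symbol_word]. *)
Let cocycle_weyl_word i j (ij : i != j) (ji : j != i) (u u' : A) p q D :
    pi u * pi u = 1 -> pi u' = pi u -> d1 u' = - d1 u -> d2 u' = - d2 u ->
  cocycle_word (weyl_word ij ji u u') (diag2 i j p q, D) =
    (diag2 i j (q + pi u * d2 u) (p - pi u * d2 u),
     D + d1 u * (pi u * (q - p) + d2 u)).
Proof.
move=> uu pu' d1u' d2u'; apply: state_eq => [r c|] /=.
  rewrite /dlog_step d2N rmorphN d2u' pu' /diag2.
  by split_eq; ring: uu.
rewrite /dlog_step !d1N d1u' d2N rmorphN d2u' pu' /diag2.
by split_eq; ring: uu.
Qed.

(** The factor w(-u) contributes 2 d1(u) d2(v), the factor w(u v) contributes -d1(u) d2(v), and the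
    other two nothing. *)
Lemma cocycle_symbol_word i j (ij : i != j) (ji : j != i) (u u' v v' : A) :
    u * u' = 1 -> v * v' = 1 -> pi u = 1 -> pi v = 1 ->
    d2 u = 0 -> d1 v = 0 ->
  (cocycle_word (symbol_word ij ji u u' v v') (fun _ _ =>
    0, 0)).2 = d1 u * d2 v.
Proof.
move=> uu' vv' pu pv d2u d1v.
have pu' : pi u' = 1 by rewrite -[LHS]mul1r -pu -rmorphM uu' rmorph1.
have pv' : pi v' = 1 by rewrite -[LHS]mul1r -pv -rmorphM vv' rmorph1.
have d1u' : d1 u' = - d1 u.
  by apply: (addrI (d1 u)); rewrite subrr -d1_1 -uu' d1M pu pu'; ring.
have d2u' : d2 u' = 0 by rewrite -d2_1 -uu' d2M pu d2u; ring.
have d1v' : d1 v' = 0 by rewrite -d1_1 -vv' d1M pv d1v; ring.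
have d2v' : d2 v' = - d2 v.
  by apply: (addrI (d2 v)); rewrite subrr -d2_1 -vv' d2M pv pv'; ring.
have -> : ((fun _ _ => 0) : infmx k, 0 : k) = (diag2 i j 0 0, 0).
  by apply: state_eq => // r c; rewrite /diag2; ring.
rewrite /symbol_word !cocycle_word_cat.
rewrite !cocycle_weyl_word /= ?(rmorphN, rmorphM, rmorph1) /= ?(d1N, d2N, d1M,
  d2M);
  rewrite ?(pu, pv, pu', pv', d1_1, d2_1, d2u, d1v, d1u', d2u', d1v', d2v') /=;
    ring.
Qed.

End SteinbergCocycle.

(** * One-dimensional local rings *)

(** A nonconstant divisor q of X^p - c of least degree is irreducible, hence coprime to its
    derivative. As X^p - c has derivative 0, even q^p divides it, which forces q to be linear. *)
Lemma perfect_root (k : fieldType) p (charK : p \in [pchar k]) :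
  perfect_field k -> forall c : k, exists z, z ^+ p = c.
Proof.
move=> perfect_k c; have p_gt0 : (0 < p)%N := prime_gt0 (pcharf_prime charK).
pose f : {poly k} := 'X^p - c%:P.
have size_f : size f = p.+1 by rewrite size_XnsubC.
have f0 : f != 0 by rewrite -size_poly_gt0 size_f.
have df : f^`() = 0.
  by rewrite derivB derivC derivXn subr0 -mulr_natr -polyC_natr (pcharf0 charK)
    mulr0.
have ex_q : exists n, `[< exists q :
  {poly k}, [/\ q %| f, (1 < size q)%N & size q = n] >].
  by exists p.+1; apply/asboolP; exists f; rewrite dvdpp size_f.
case: (ex_minnP ex_q) => _ /asboolP[q [qf q_gt1 <-]] q_min.
have q0 : q != 0 by rewrite -size_poly_gt0 (ltn_trans _ q_gt1).
have irr_q : irreducible_poly q.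
  split=> // r r1 rq; rewrite -dvdp_size_eqp // eqn_leq dvdp_leq //=.
  apply: q_min; apply/asboolP; exists r; split=> //; first exact: dvdp_trans qf.
  rewrite ltn_neqAle eq_sym r1 size_poly_gt0.
  by apply: contraTneq rq => ->; rewrite dvd0p.
have := perfect_k q irr_q; rewrite unlock => coprime_q.
have dvd_q j : (j <= p)%N -> q ^+ j %| f.
  elim: j => [|j IHj] ltjp; first exact: dvd1p.
  have /dvdpP[r fE] := IHj (ltnW ltjp).
  have [->|j0] := posnP j; first by rewrite expr1.
  rewrite fE exprS dvdp_mul2r ?expf_neq0 //.
  (* Differentiate f = r q^j; since j is nonzero in k and q is coprime to q', it follows that q
     divides r. *)
  have E : j%:R *: (r * q^`()) = - r^`() * q.
    have qj0 : q ^+ j.-1 != 0 by rewrite expf_neq0.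
    apply: (mulfI qj0); apply/eqP; rewrite -subr_eq0; apply/eqP.
    have qj : q ^+ j = q * q ^+ j.-1 by rewrite -exprS prednK.
    rewrite -df fE derivM deriv_exp qj -mulr_natl -mul_polyC.
    by ring.
  have jk : j%:R != 0 :> k.
    by rewrite -(dvdn_pcharf charK) gtnNdvd.
  by rewrite -(Gauss_dvdpl _ coprime_q) -(dvdpZr _ _ jk) E dvdp_mull.
have size_q : size q = 2.
  have := dvdp_leq f0 (dvd_q p (leqnn p)).
  have := size_exp q p; rewrite size_f.
  case: (size (q ^+ p)) => [|s] /= Es le_s.
    by move/esym/eqP: Es; rewrite muln_eq0 -!leqn0; case:
      (size q) q_gt1 p_gt0 => [|[|]] //; case: (p).
  move: le_s; rewrite Es ltnS -{2}[p]mul1n leq_pmul2r //.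
  by case: (size q) q_gt1 => [|[|[|]]].
have [z qz] := poly2_root size_q; exists z.
have := root_dvdp qf qz.
by rewrite /root /f !hornerE subr_eq0 => /eqP.
Qed.

(** * Maximal elements and prime ideals in Noetherian rings *)

Section NoetherianRing.
Variable A : comNzRingType.
Hypothesis noetherianA : noetherian_ring A.

Lemma ideal_sum (I : {pred A}) n (c x : 'I_n -> A) :
  idealr_closed I -> (forall i, x i \in I) -> \sum_(i < n) c i * x i \in I.
Proof.
case=> I0 _ IM xI; elim/big_ind: _ => // [y z yI zI|i _].
  by rewrite -[y]mul1r IM.
by rewrite -[_ * _]addr0 IM.
Qed.

Lemma noetherian_chain (I : nat -> {pred A}) :
    (forall n, idealr_closed (I n)) -> (forall n, {subset I n <= I n.+1}) ->
  exists n, forall n', {subset I n' <= I n}.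
Proof.
move=> idI subI.
have monoI n n' : (n <= n')%N -> {subset I n <= I n'}.
  by move=> /subnK <-; elim: (n' - n)%N => [|d IHd] x //= /IHd /subI.
pose U : {pred A} := fun x => `[< exists n, x \in I n >].
have UP x : reflect (exists n, x \in I n) (x \in U) by exact: asboolP.
have idU : idealr_closed U.
  split; first by apply/UP; exists 0%N; case: (idI 0%N).
    by apply/UP => -[n]; apply/negP; case: (idI n).
  move=> a x y /UP[n xn] /UP[n' yn']; apply/UP; exists (maxn n n').
  case: (idI (maxn n n')) => _ _; apply; first exact: monoI (leq_maxl _ _) _ xn.
  exact: monoI (leq_maxr _ _) _ yn'.
have [s sU] := noetherianA idU.
have /choice[f fP] : forall i : 'I_(size s), exists n, s`_i \in I n.
  move=> i; apply/UP/sU; exists (fun j => (j == i)%:R).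
  rewrite (bigD1 i) //= eqxx mul1r big1 ?addr0 // => j /negPf->.
  by rewrite mul0r.
exists (\max_i f i) => n' x xn'.
have /sU[c ->] : x \in U by apply/UP; exists n'.
by apply: ideal_sum => // i; apply: monoI (fP i); exact: leq_bigmax.
Qed.

(** The ideals are indexed by arbitrary parameters, so that later choices can maximise over elements
    or pairs. Without a maximum, choice builds a strictly increasing chain. *)
Lemma noetherian_max (T : Type) (P : T -> Prop) (f : T -> {pred A}) t0 :
    P t0 -> (forall t, P t -> idealr_closed (f t)) ->
  exists2 t, P t & forall t', P t' -> {subset f t <= f t'} ->
    {subset f t' <= f t}.
Proof.
move=> Pt0 idf; apply: contrapT => nomax.
have /choice[g gP] : forall t : {t | P t}, exists t' : {t | P t},
    {subset f (sval t) <= f (sval t')} /\ ~ {subset f (sval t') <= f (sval t)}.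
  move=> [t Pt]; apply: contrapT => no; apply: nomax; exists t => // t' Pt' sub.
  by apply: contrapT => nsub; apply: no; exists (exist _ t' Pt').
pose h n := iter n g (exist _ t0 Pt0).
have [n] := @noetherian_chain (fun n => f (sval (h n)))
  (fun n => idf _ (svalP (h n))) (fun n => (gP (h n)).1).
by move/(_ n.+1); case: (gP (h n)).
Qed.

(** Krull's argument: an ideal maximal among those that contain I and avoid the multiplicative set S
    is prime. *)
Lemma prime_avoiding (S : A -> Prop) (I : {pred A}) :
    idealr_closed I -> S 1 -> (forall x y, S x -> S y -> S (x * y)) ->
    (forall x, x \in I -> ~ S x) ->
  exists P : {pred A},
    [/\ prime_ideal P, {subset I <= P} & forall x, x \in P -> ~ S x].
Proof.
move=> idI S1 SM disjI.
have [P [idP subP disjP] maxP] := @noetherian_max {pred A}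
  (fun P => [/\ idealr_closed P, {subset I <= P} & forall x, x \in P -> ~ S x])
  id I (And3 idI (fun _ h => h) disjI) (fun _ '(And3 h _ _) => h).
exists P; split=> //; split=> // u v uv; apply/negPn/negP.
rewrite negb_or => /andP[uP vP]; case: idP => P0 _ PD.
have big w : w \notin P -> exists c x, [/\ x \in P & S (x + c * w)].
  move=> wP; apply: contrapT => no.
  pose Q : {pred A} := fun z => `[< exists c x, x \in P /\ z = x + c * w >].
  have QP z : reflect (exists c x, x \in P /\ z = x + c * w) (z \in Q).
    exact: asboolP.
  have disjQ z : z \in Q -> ~ S z.
    by move=> /QP[c [x [xP ->]]] Sz; apply: no; exists c, x.
  have subQ : {subset P <= Q}.
    by move=> x xP; apply/QP; exists 0, x; rewrite mul0r addr0.
  move/negP: wP; apply; apply: (maxP Q) => //; last first.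
    by apply/QP; exists 1, 0; rewrite mul1r add0r.
  split=> //; last by move=> x /subP/subQ.
  split; first exact: subQ.
    by apply/negP => /disjQ.
  move=> a _ _ /QP[c [x [xP ->]]] /QP[c' [x' [xP' ->]]].
  apply/QP; exists (a * c + c'), (a * x + x'); split; first exact: PD.
  by ring.
have [c [x [xP Sx]]] := big u uP; have [c' [x' [xP' Sx']]] := big v vP.
apply: (disjP _ _ (SM _ _ Sx Sx')).
have PM a z : z \in P -> a * z \in P.
  by move=> zP; rewrite -[a * z]addr0 PD.
have -> : (x + c * u) * (x' + c' * v) =
    (x' + c' * v) * x + ((c * u) * x' + (c * c') * (u * v)) by ring.
by rewrite PD // PD // PM.
Qed.

End NoetherianRing.

(** * Reduced local rings: regular elements and dimension one *)

Section LocalRing.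
Variables (A : comNzRingType) (m : {pred A}) (k : fieldType).
Variable pi : {rmorphism A -> k}.
Hypotheses (noetherianA : noetherian_ring A) (reducedA : reduced_ring A).
Hypotheses (localm : local_ring_at m) (residue_pi : is_residue_field pi).

Lemma in_maximal x : (x \in m) = (pi x == 0).
Proof. by case: residue_pi => _; apply; case: localm. Qed.

Lemma maximal_idealr : idealr_closed m.
Proof. by case: localm => -[]. Qed.

Lemma maximalM a x : x \in m -> a * x \in m.
Proof. by rewrite !in_maximal rmorphM => /eqP->; rewrite mulr0. Qed.

Lemma maximalX n x : x ^+ n \in m -> x \in m.
Proof. by rewrite !in_maximal rmorphXn expf_eq0 => /andP[]. Qed.

Lemma unit_notin_maximal a : a \notin m -> exists b, a * b = 1.
Proof.
move=> am; apply: contrapT => nounit.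
pose I : {pred A} := fun x => `[< exists c, x = c * a >].
have IP x : reflect (exists c, x = c * a) (x \in I) by exact: asboolP.
have idI : idealr_closed I.
  split; first by apply/IP; exists 0; rewrite mul0r.
    by apply/IP => -[c E]; apply: nounit; exists c; rewrite mulrC.
  move=> c _ _ /IP[x ->] /IP[y ->]; apply/IP.
  by exists (c * x + y); rewrite mulrDl mulrA.
have [J [idJ subJ] maxJ] := @noetherian_max _ noetherianA {pred A}
  (fun J => idealr_closed J /\ {subset I <= J}) id I (conj idI (fun _ h => h))
  (fun _ => @proj1 _ _).
have maximalJ : maximal_ideal J.
  split=> // J' idJ' sub; apply: maxJ => //; split=> // x /subJ; exact: sub.
move/negP: am; apply; rewrite -(localm.2 J) //; apply: subJ.
by apply/IP; exists 1; rewrite mul1r.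
Qed.

Lemma ideal_sub_maximal I : idealr_closed I -> {subset I <= m}.
Proof.
case=> I0 I1 ID x xI; apply/negPn/negP => /unit_notin_maximal[y xy].
by move/negP: I1; apply; rewrite -xy mulrC -[_ * _]addr0 ID.
Qed.

Lemma lreg_annP (x : A) : GRing.lreg x <-> forall c, c * x = 0 -> c = 0.
Proof.
split=> [rx c cx|x0 a b ab]; first by apply: rx; rewrite mulrC cx mulr0.
by apply/eqP; rewrite -subr_eq0; apply/eqP/x0; rewrite mulrC mulrBr ab subrr.
Qed.

Lemma reduced_mul0 (x y : A) : x * (y * y) = 0 -> x * y = 0.
Proof. by move=> E; apply: (@reducedA _ 2); ring: E. Qed.

(* Maximizing the double annihilator of a + b minimizes its annihilator; any
   c <> 0 killed by a + b could be added to b. *)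
Lemma regular_complement (a : A) : exists b, a * b = 0 /\ GRing.lreg (a + b).
Proof.
apply: contrapT => nob.
pose f (b : A) : {pred A} := fun z => `[< forall c, c * (a + b) = 0 ->
  c * z = 0 >].
have fP b z : reflect (forall c, c * (a + b) = 0 -> c * z = 0) (z \in f b).
  exact: asboolP.
have zd b : a * b = 0 -> exists2 c, c * (a + b) = 0 & c <> 0.
  move=> ab; apply: contrapT => noc; apply: nob; exists b; split=> //.
  by apply/lreg_annP => c cab; apply: contrapT => c0; apply: noc; exists c.
have idf b : a * b = 0 -> idealr_closed (f b).
  move=> ab; split; first by apply/fP => c _; rewrite mulr0.
    by have [c cab c0] := zd b ab; apply/fP => /(_ c cab); rewrite mulr1.
  move=> c x y /fP xf /fP yf; apply/fP => d dab.
  by rewrite mulrDr yf // mulrCA xf // mulr0 addr0.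
have [b ab maxb] := noetherian_max noetherianA (mulr0 a) idf.
have [c cab c0] := zd b ab.
have ca : c * a = 0.
  apply: reduced_mul0; transitivity (c * (a + b) * a - c * (a * b));
    first by ring.
  by rewrite cab ab mul0r mulr0 subr0.
have cb : c * b = 0 by rewrite mulrDr ca add0r in cab.
have ab' : a * (b + c) = 0 by rewrite mulrDr ab [a * c]mulrC ca addr0.
have sub : {subset f b <= f (b + c)}.
  move=> z /fP zf; apply/fP => d dab; apply: zf.
  have dc : d * c = 0.
    apply: reduced_mul0.
    transitivity (d * (a + (b + c)) * c - d * (c * a) - d * (c * b));
      first by ring.
    by rewrite dab ca cb mul0r !mulr0 !subr0.
  by rewrite addrA mulrDr dc addr0 in dab.
have : a + (b + c) \in f (b + c) by apply/fP.
move=> /(maxb _ ab' sub)/fP/(_ c cab) E; apply: c0.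
by apply: (@reducedA _ 2); rewrite expr2; rewrite addrA mulrDr cab add0r in E.
Qed.

(** If x + b were outside m, then b would be a unit, and x b = 0 would give x = 0. *)
Lemma regular_in_maximal x : x \in m -> x <> 0 ->
  exists2 h, h \in m & GRing.lreg h.
Proof.
move=> xm x0; have [b [xb reg]] := regular_complement x.
exists (x + b) => //; apply/negPn/negP => xbm.
have /unit_notin_maximal[c bc] : b \notin m.
  apply: contra xbm; rewrite !in_maximal rmorphD => /eqP->.
  by rewrite addr0 -in_maximal.
by apply: x0; rewrite -[x]mulr1 -bc mulrA xb mul0r.
Qed.

(* The prime ideals containing a regular element are not minimal. *)
Lemma dim1_nilpotent h a : has_krull_dim A 1 -> GRing.lreg h -> a \in m ->
  exists n c, a ^+ n = c * h.
Proof.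
move=> [_ nochain] /lreg_annP regh am; apply: contrapT => no.
pose I : {pred A} := fun x => `[< exists c, x = c * h >].
have IP x : reflect (exists c, x = c * h) (x \in I) by exact: asboolP.
have idI : idealr_closed I.
  split; first by apply/IP; exists 0; rewrite mul0r.
    by apply/IP => -[c E]; apply: no; exists 0%N, c; rewrite expr0.
  move=> c _ _ /IP[x ->] /IP[y ->]; apply/IP.
  by exists (c * x + y); rewrite mulrDl mulrA.
have [||x xI [n xn]|P [primeP subP disjP]] :=
    prime_avoiding noetherianA (S := fun x => exists n, x = a ^+ n) idI.
- by exists 0%N.
- by move=> x y [i ->] [j ->]; exists (i + j)%N; rewrite exprD.
- by move/IP: xI => [c xc]; apply: no; exists n, c; rewrite -xn.
have id0 : idealr_closed (pred1 (0 : A)).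
  split; rewrite ?inE ?oner_eq0 // => c x y; rewrite !inE => /eqP-> /eqP->.
  by rewrite mulr0 addr0.
have P1 : 1 \notin P by case: primeP => -[].
(* P contains h but no power of a. A prime Q avoiding all s h^n with s outside P lies in P and omits
   h, so Q, P, m is a chain of length 2. *)
have [||x /eqP-> [n [s [sP E]]]|Q [primeQ _ disjQ]] :=
    prime_avoiding noetherianA
      (S := fun x => exists n s, s \notin P /\ x = s * h ^+ n) id0.
- by exists 0%N, 1; rewrite mulr1.
- move=> x y [i [s [sP ->]]] [j [t [tP ->]]]; exists (i + j)%N, (s * t).
  split; last by rewrite exprD; ring.
  by apply/negP => /primeP.2; rewrite (negPf sP) (negPf tP).
- have P0 : 0 \in P by case: primeP => -[].
  move/negP: sP; apply; suff -> : s = 0 by [].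
  by elim: n E => [|n IHn]; rewrite ?expr0 ?mulr1 // exprSr mulrA =>
    /esym/regh/esym.
have hP : h \in P by apply: subP; apply/IP; exists 1; rewrite mul1r.
have prime_m : prime_ideal m.
  split; first exact: maximal_idealr.
  by move=> u v; rewrite !in_maximal rmorphM mulf_eq0.
apply: nochain; exists (fun i =>
  if i is i'.+1 then if i' is 0 then P else m else Q).
split=> [[|[|i]] //|[|[|i]] // _]; split.
- move=> x xQ; apply/negPn/negP => xP; apply: (disjQ x) => //.
  by exists 0%N, x; rewrite mulr1.
- by move/(_ h hP)/disjQ; apply; exists 1%N, 1; rewrite mul1r.
- by apply: ideal_sub_maximal; case: primeP.
- by move/(_ a am)/disjP; apply; exists 1%N.
Qed.

End LocalRing.

(** * The integral closure *)

Section Normalisation.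
Variables (A : comNzRingType) (m : {pred A}) (k : fieldType).
Variable pi : {rmorphism A -> k}.
Hypotheses (noetherianA : noetherian_ring A) (reducedA : reduced_ring A).
Hypotheses (localm : local_ring_at m) (residue_pi : is_residue_field pi).
Hypothesis dimA : has_krull_dim A 1.
Variables (F : comUnitRingType) (iota : {rmorphism A -> F}).
Hypothesis quotient_iota : is_total_quotient_ring iota.

Let O (y : F) := integralOver iota y.
Let O0 : O 0 := integral0 iota.
Let O1 : O 1 := integral1 iota.
Let OA a : O (iota a) := integral_id iota a.
Let OD y z : O y -> O z -> O (y + z) := @integral_add _ _ iota y z.
Let OB y z : O y -> O z -> O (y - z) := @integral_sub _ _ iota y z.
Let ON y : O y -> O (- y) := @integral_opp _ _ iota y.
Let OM y z : O y -> O z -> O (y * z) := @integral_mul _ _ iota y z.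
Let OX n y : O y -> O (y ^+ n) := @integral_exp _ _ iota n y.

Let in_m := in_maximal localm residue_pi.

Lemma common_denominator (s : seq F) :
  exists2 d : A, GRing.lreg d & forall y, y \in s ->
    exists a, iota a = iota d * y.
Proof.
case: quotient_iota => inj_iota unit_iota frac.
elim: s => [|y s [d regd dP]].
  by exists 1 => //; apply/lreg_annP => c; rewrite mulr1.
have [a [t [regt ->]]] := frac y; exists (d * t); first exact: GRing.lregM.
move=> z; rewrite inE => /predU1P[->|/dP[b bz]].
  by exists (d * a); rewrite !rmorphM mulrA mulrAC mulrK ?unit_iota // mulrC.
by exists (t * b); rewrite !rmorphM bz; ring.
Qed.

(** Take a common denominator of the generators of O, times h so that g O lands in m and not merely
    in A. *)
Lemma conductor h : finite_normalisation iota -> h \in m -> GRing.lreg h ->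
  exists g, [/\ g \in m, GRing.lreg g &
    forall y, O y -> exists2 a, a \in m & iota a = iota g * y].
Proof.
move=> [s sP] hm regh; have [d regd dP] := common_denominator s.
exists (d * h); split; [exact: (maximalM localm residue_pi)|exact:
  GRing.lregM|].
move=> y /sP[c ->].
have /choice[b bP] : forall i : 'I_(size s), exists a, iota a = iota d * s`_i.
  by move=> i; apply/dP/mem_nth.
exists ((\sum_(i < size s) c i * b i) * h).
  exact: (maximalM localm residue_pi).
rewrite !rmorphM rmorph_sum /= mulrAC; congr (_ * _).
rewrite mulr_sumr; apply: eq_bigr => i _.
by rewrite rmorphM bP mulrCA.
Qed.

(** * The Jacobson radical of O: nilpotence, a generator, and Frobenius on the quotient *)

Section Conductor.
Variables (p : nat) (g : A).
Hypotheses (charA : p \in [pchar A]) (regg : GRing.lreg g).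
Hypothesis gO : forall y, O y -> exists2 a, a \in m & iota a = iota g * y.

Let G := iota g.
Let inj_iota : injective iota. Proof. by case: quotient_iota. Qed.
Let UG : G \is a GRing.unit. Proof. by case: quotient_iota => _ + _; apply. Qed.
Let charF : p \in [pchar F]. Proof. exact: rmorph_pchar charA. Qed.
Let p_gt1 : (1 < p)%N. Proof. exact/prime_gt1/(pcharf_prime charA). Qed.

(** O is a Noetherian A-module: multiplication by g turns its submodules into ideals of A, which are
    proper because g O lies in m. *)
Lemma submodule_max (T : Type) (P : T -> Prop) (N : T -> F -> Prop) t0 :
    P t0 ->
    (forall t, P t -> [/\ N t 0, forall a y z, N t y -> N t z ->
      N t (iota a * y + z)
      & forall y, N t y -> O y]) ->
  exists2 t, P t & forall t', P t' -> (forall y, N t y -> N t' y) ->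
    forall y, N t' y -> N t y.
Proof.
move=> Pt0 subN; pose f t : {pred A} := fun a =>
  `[< exists2 y, N t y & iota a = G * y >].
have fP t a : reflect (exists2 y, N t y & iota a = G * y) (a \in f t).
  exact: asboolP.
have idf t : P t -> idealr_closed (f t).
  move=> /subN[N0 ND NO]; split.
  - by apply/fP; exists 0; rewrite ?mulr0 ?rmorph0.
  - apply/fP => -[y /NO/gO[a am]]; rewrite -/G => <- /inj_iota a1.
    by move: am; rewrite -a1 in_m rmorph1 oner_eq0.
  - move=> a b c /fP[y Ny bE] /fP[z Nz cE]; apply/fP; exists (iota a * y + z).
      exact: ND.
    by rewrite rmorphD rmorphM bE cE; ring.
have [t Pt maxt] := noetherian_max noetherianA Pt0 idf.
exists t => // t' Pt' sub y Ny.
have [_ _ /(_ _ Ny)/gO[a _ aE]] := subN t' Pt'.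
have /fP[z Nz] : a \in f t.
  apply: (maxt t') => // [b /fP[z Nz bE]|]; last by apply/fP; exists y.
  by apply/fP; exists z => //; exact: sub.
by rewrite aE => /(mulrI UG)->.
Qed.

(* O / gO is Artinian, so that this is the Jacobson radical of O. *)
Definition jacobson (y : F) := O y /\ exists n z, O z /\ y ^+ n = G * z.
Let J := jacobson.

Lemma jacobson_integral y : J y -> O y. Proof. by case. Qed.

Lemma jacobsonM y z : O z -> J y -> J (z * y).
Proof.
move=> Oz [Oy [n [w [Ow yn]]]]; split; first exact: OM.
by exists n, (z ^+ n * w); split; [exact/OM/Ow/OX | rewrite exprMn yn mulrCA].
Qed.

Lemma jacobson_leq y n z n' : O y -> O z -> y ^+ n = G * z -> (n <= n')%N ->
  exists2 w, O w & y ^+ n' = G * w.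
Proof.
move=> Oy Oz yn /subnK<-; exists (y ^+ (n' - n) * z); first exact/OM/Oz/OX.
by rewrite exprD yn mulrCA.
Qed.

(** Raising to a large power of p is additive, so no binomial expansion is needed. *)
Lemma jacobsonD y z : J y -> J z -> J (y + z).
Proof.
move=> [Oy [n [v [Ov yn]]]] [Oz [n' [w [Ow zn]]]]; split; first exact: OD.
have le_exp i : (i <= n + n')%N -> (i <= p ^ (n + n'))%N.
  by move=> le_i; apply: leq_trans le_i (ltnW (ltn_expl _ p_gt1)).
have [v' Ov' yE] := jacobson_leq Oy Ov yn (le_exp _ (leq_addr _ _)).
have [w' Ow' zE] := jacobson_leq Oz Ow zn (le_exp _ (leq_addl _ _)).
exists (p ^ (n + n'))%N, (v' + w'); split; first exact: OD.
by rewrite (frobeniusD _ _ _ charF) yE zE mulrDr.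
Qed.

Lemma jacobsonN y : J y -> J (- y).
Proof. by rewrite -mulN1r; apply: jacobsonM; exact: ON. Qed.

Lemma jacobsonB y z : J y -> J z -> J (y - z).
Proof. by move=> Jy Jz; exact/jacobsonD/jacobsonN. Qed.

Lemma jacobson_root n y : O y -> J (y ^+ n) -> J y.
Proof.
move=> Oy [_ [n' [z [Oz yn]]]]; split=> //.
by exists (n * n')%N, z; split; rewrite // exprM.
Qed.

Lemma jacobsonX n y : J y -> (0 < n)%N -> J (y ^+ n).
Proof.
move=> Jy; case: n => // n _; rewrite exprSr.
by apply: jacobsonM => //; exact/OX/jacobson_integral.
Qed.

Lemma jacobson_conductor y : O y -> J (G * y).
Proof.
move=> Oy; rewrite mulrC; apply: jacobsonM => //; split; first exact: OA.
by exists 1%N, 1; rewrite expr1 mulr1.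
Qed.

Lemma jacobson0 : J 0.
Proof. by rewrite -(mulr0 G); exact: jacobson_conductor. Qed.

Lemma jacobson_iota a : J (iota a) <-> a \in m.
Proof.
split=> [[_ [n [z [/gO[b bm] <-]]]]|am].
  rewrite -rmorphXn => /inj_iota E.
  by apply: (maximalX localm residue_pi (n := n)); rewrite E.
split; first exact: OA.
have [n [c an]] := dim1_nilpotent noetherianA localm residue_pi dimA regg am.
by exists n, (iota c); rewrite -rmorphXn an rmorphM mulrC.
Qed.

Lemma jacobson_proper : ~ J 1.
Proof. by rewrite -(rmorph1 iota) jacobson_iota in_m rmorph1 oner_eq0. Qed.

(** Some power of y comes from m, and in dimension one elements of m are nilpotent modulo any
    regular element. *)
Lemma jacobson_nilpotent h y : GRing.lreg h -> J y ->
  exists n z, O z /\ y ^+ n = iota h * z.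
Proof.
move=> regh [_ [n [z [/gO[b bm] <- yn]]]].
have [n' [c bn]] := dim1_nilpotent noetherianA localm residue_pi dimA regh bm.
exists (n * n')%N, (iota c); split; first exact: OA.
by rewrite exprM yn -rmorphXn bn rmorphM mulrC.
Qed.

(** Multiplied by a finite geometric sum, 1 - y becomes 1 - y^n with y^n in m, a unit of A. *)
Lemma jacobson_unit y : J y -> exists2 z, O z & (1 - y) * z = 1.
Proof.
move=> [Oy [n [z [/gO[b bm] <- yn]]]].
have /(unit_notin_maximal noetherianA localm)[c bc] : 1 - b \notin m.
  by rewrite in_m rmorphB rmorph1 (eqP (_ :
    pi b == 0)) ?subr0 ?oner_eq0 // -in_m.
exists ((\sum_(i < n) y ^+ i) * iota c).
  apply: OM; last exact: OA.
  by elim/big_ind: _ => [|v w|i _]; [exact: O0 | exact: OD | exact: OX].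
have := subrX1 y n; rewrite yn => E; rewrite mulrA.
transitivity (- ((y - 1) * (\sum_(i < n) y ^+ i)) * iota c); first by ring.
by rewrite -E opprB -(rmorph1 iota) -rmorphB -rmorphM bc.
Qed.

Lemma jacobson_unit_lift w w' : O w -> O w' -> J (1 - w * w') ->
  exists2 z, O z & w * z = 1.
Proof.
move=> Ow Ow' /jacobson_unit[z Oz]; rewrite opprB addrC subrK => E.
by exists (w' * z); [exact: OM | rewrite mulrA].
Qed.

(* Powers of b multiplied by an element of J stay in O, so that they span a
   finitely generated A-module. *)
Lemma jacobson_stable_integral b : (forall y, J y -> J (b * y)) -> O b.
Proof.
move=> Jb; pose N n y := exists q : {poly A}, (size q <= n)%N /\
  y = (map_poly iota q).[b] * G.
have JN (q : {poly A}) : J ((map_poly iota q).[b] * G).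
  elim/poly_ind: q => [|q c IHq].
    by rewrite rmorph0 horner0 mul0r; exact: jacobson0.
  rewrite rmorphD rmorphM /= map_polyX map_polyC /= hornerD hornerMX hornerC.
  rewrite mulrDl mulrAC [_ * b]mulrC; apply: jacobsonD; first exact: Jb.
  by rewrite mulrC; apply: jacobson_conductor; exact: OA.
have [||n _ maxn] := @submodule_max nat (fun _ => True) N 0%N => //.
  move=> n _; split.
  - by exists 0; rewrite size_poly0 rmorph0 horner0 mul0r.
  - move=> a _ _ [q [sq ->]] [r [sr ->]]; exists (a%:P * q + r); split.
      rewrite (leq_trans (size_polyD _ _)) // geq_max sr andbT mul_polyC.
      exact: leq_trans (size_scale_leq _ _) sq.
    by rewrite rmorphD rmorphM /= map_polyC hornerD hornerM hornerC /=; ring.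
  - by move=> _ [q [_ ->]]; exact/jacobson_integral/JN.
have [||q [sq E]] := maxn n.+1 I _ (b ^+ n * G).
- by move=> y [q [sq ->]]; exists q; split=> //; exact: leqW.
- by exists 'X^n; rewrite size_polyXn map_polyXn hornerXn.
exists ('X^n - q).
  by rewrite monicE lead_coefDl ?lead_coefXn // size_polyN size_polyXn.
apply/rootP; rewrite rmorphB /= map_polyXn hornerD hornerN hornerXn.
by rewrite -(mulIr UG E) subrr.
Qed.

Let JO := jacobson_integral.

(* Otherwise c u is integral for every u with u J in O. Let T be the ideal of the
   y with c^s y in gO for some s. As J is nilpotent modulo gO, some x outside T
   satisfies x J in T, and u = c^s x / g then puts x in T. *)
Lemma jacobson_pairing c : O c -> ~ J c ->
  exists u j, [/\ forall y, J y -> O (u * y), J j & ~ J (c * u * j)].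
Proof.
move=> Oc Jc; apply: contrapT => no.
have Ocu u : (forall y, J y -> O (u * y)) -> O (c * u).
  move=> uJ; apply: jacobson_stable_integral => j Jj; apply: contrapT => Jcuj.
  by apply: no; exists u, j.
pose N s y := O y /\ exists z, O z /\ c ^+ s * y = G * z.
have NM s y z : O z -> N s y -> N s (z * y).
  move=> Oz [Oy [w [Ow E]]]; split; first exact: OM.
  by exists (z * w); split; [exact: OM | rewrite mulrCA E mulrCA].
have ND s y z : N s y -> N s z -> N s (y + z).
  move=> [Oy [v [Ov yE]]] [Oz [w [Ow zE]]]; split; first exact: OD.
  by exists (v + w); split; [exact: OD | rewrite !mulrDr yE zE].
have N0 s : N s 0 by split=> //; exists 0; rewrite !mulr0.
have [||s _ maxs] := @submodule_max nat (fun _ => True) N 0%N => //.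
  move=> s _; split=> // [a y z Ny Nz|y []//].
  by apply: ND => //; exact: NM.
pose M x y := O y /\ N s (x * y).
have [||x [Ox Nx] maxx] := @submodule_max F (fun x => O x /\ ~ N s x) M 1.
- split=> // -[_ [z [Oz E]]]; apply: Jc; split=> //.
  by exists s, z; split; rewrite // -E mulr1.
- move=> x [Ox _]; split=> [|a y z [Oy Ny] [Oz Nz]|y []//].
    by split; rewrite ?mulr0; [exact: O0 | exact: N0].
  split; first exact/OD/Oz/OM.
  by rewrite mulrDr mulrCA; apply: ND => //; exact: NM.
have xJ j : J j -> N s (x * j).
  move=> Jj; apply: contrapT => Nxj.
  (* The annihilator of x modulo T is maximal: if x j is outside T, so is each x j^n, although some
     j^n lies in g O. *)
  have Nxjn n : ~ N s (x * j ^+ n).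
    elim: n => [|n IHn]; first by rewrite expr0 mulr1.
    rewrite exprSr mulrA => Nj; apply: Nxj.
    have [] // := maxx (x * j ^+ n) _ _ j _; last by split; [exact: JO|].
      by split=> //; exact/OM/OX/JO.
    by move=> y [Oy Ny]; split; rewrite // mulrAC mulrC; apply: NM => //;
      exact/OX/JO.
  have [Oj [n [z [Oz jn]]]] := Jj; apply: (Nxjn n); rewrite jn.
  split; first by apply: OM => //; apply: OM => //; exact: OA.
  exists (c ^+ s * x * z); split; first by apply: OM => //; apply: OM => //;
    exact: OX.
  by rewrite -/G; ring.
have /Ocu : forall y, J y -> O (c ^+ s * x / G * y).
  move=> y /xJ[_ [z [Oz E]]].
  by rewrite mulrAC -[c ^+ s * x * y]mulrA E mulrC mulKr.
move=> Ow; apply: Nx; apply: (maxs s.+1 I) => [y [Oy [z [Oz E]]]|].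
  by split=> //; exists (c * z); split; [exact:
    OM | rewrite exprS -mulrA E mulrCA].
split=> //; exists (c * (c ^+ s * x / G)); split=> //.
by rewrite exprS mulrCA [G * _]mulrC mulrVK // mulrA.
Qed.

Lemma integral_polynomial (q : {poly A}) y : O y -> O (map_poly iota q).[y].
Proof.
move=> Oy; elim/poly_ind: q => [|q c IHq]; first by rewrite rmorph0 horner0.
rewrite rmorphD rmorphM /= map_polyX map_polyC /= hornerD hornerMX hornerC.
by apply: OD; [exact: OM | exact: OA].
Qed.

(** In a monic equation of w modulo J, factors w are cancelled as long as the constant term lies in
    m; once it is a unit of A, the equation exhibits an inverse. *)
Lemma regular_mod_jacobson_unit w : O w -> (forall c, O c -> J (c * w) ->
  J c) ->
  exists2 z, O z & w * z = 1.
Proof.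
move=> Ow regw; suff [w' Ow' Jw'] : exists2 w', O w' & J (1 - w * w').
  exact: jacobson_unit_lift Jw'.
have [q mon_q /rootP qw] := Ow.
have {qw} : J (map_poly iota q).[w] by rewrite qw; exact: jacobson0.
elim/poly_ind: q mon_q => [|q c IHq].
  by rewrite monicE lead_coef0 eq_sym oner_eq0.
have [->|q0] := eqVneq q 0.
  rewrite mul0r add0r monicE lead_coefC => /eqP->.
  by rewrite map_polyC hornerC /= rmorph1 => /jacobson_proper.
rewrite monicE lead_coefDl ?lead_coefMX; last first.
  by rewrite size_mulX // (leq_ltn_trans (size_polyC_leq1 _)) // ltnS
    size_poly_gt0.
rewrite -monicE => /IHq{}IHq.
rewrite rmorphD rmorphM /= map_polyX map_polyC /= hornerD hornerMX hornerC =>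
  Jq.
have Oq := integral_polynomial q Ow.
have [cm|/(unit_notin_maximal noetherianA localm)[c' cc']] := boolP (c \in m).
  apply: IHq; apply: regw => //.
  by rewrite -(addrK (iota c) (_ * w)); apply: jacobsonB => //;
    apply/jacobson_iota.
exists (- (map_poly iota q).[w] * iota c'); first exact/OM/OA/ON.
rewrite -(rmorph1 iota) -cc' rmorphM.
rewrite (_ : _ - _ = iota c' * ((map_poly iota q).[w] * w + iota c));
  last by ring.
by apply: jacobsonM => //; exact: OA.
Qed.

(* Among the products w = u j with u J in O and j in J, one with a minimal
   annihilator modulo J (hence a maximal double annihilator) is a
   non-zero-divisor, so a unit, and then J = j O. *)
Lemma jacobson_principal : exists t,
  [/\ J t, t \is a GRing.unit & forall y, J y -> exists2 z, O z & y = t * z].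
Proof.
pose P (x : F * F) := (forall y, J y -> O (x.1 * y)) /\ J x.2.
pose N (x : F * F) d := O d /\ forall c, O c -> J (c * (x.1 * x.2)) ->
  J (c * d).
have [||[u j] [/= uJ Jj] maxuj] := @submodule_max _ P N (0, 0).
- by split=> [y _|] /=; [rewrite mul0r | exact: jacobson0].
- move=> x _; split=> [|a y z [Oy Ny] [Oz Nz]|y []//].
    by split=> // c _ _; rewrite mulr0; exact: jacobson0.
  split=> [|c Oc Jc]; first exact/OD/Oz/OM.
  rewrite mulrDr mulrCA; apply: jacobsonD; last exact: Nz.
  by apply: jacobsonM => //; exact: Ny.
pose w := u * j; have Ow : O w by exact: uJ.
have regw c : O c -> J (c * w) -> J c.
  move=> Oc Jcw; apply: contrapT => Jc.
  have [b [i [bJ Ji Jcbi]]] := jacobson_pairing Oc Jc.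
  (* Among the terms c u i, c b j, c^2 b i of (u + c b)(j + c i) - w, all killed by w modulo J, the
     first one outside J serves as d. *)
  have [u' [j' [d [[u'J Jj'] Od Jdw Jd Jw']]]] : exists u' j' d,
      [/\ P (u', j'), O d, J (d * w), ~ J d & J (u' * j' - w - d)].
    have Pu : P (u, j + c * i) by split=> //; apply: jacobsonD => //; exact:
      jacobsonM.
    have Pb : P (u + c * b, j).
      split=> //= y Jy; rewrite mulrDl -mulrA.
      by apply: OD; [exact: uJ | apply/OM/bJ].
    have [Jcui|Jcui] := pselect (J (c * u * i)); last first.
      exists u, (j + c * i), (c * u * i); split=> //.
      - by rewrite -mulrA; apply: OM => //; exact: uJ.
      - rewrite (_ : _ * w = (u * i) * (c * w)); last by ring.
        by apply: jacobsonM => //; exact: uJ.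
      - by rewrite (_ : _ - _ = 0); [exact: jacobson0 | rewrite /w; ring].
    have [Jcbj|Jcbj] := pselect (J (c * b * j)); last first.
      exists (u + c * b), j, (c * b * j); split=> //.
      - by rewrite -mulrA; apply: OM => //; exact: bJ.
      - rewrite (_ : _ * w = (b * j) * (c * w)); last by ring.
        by apply: jacobsonM => //; exact: bJ.
      - by rewrite (_ : _ - _ = 0); [exact: jacobson0 | rewrite /w; ring].
    have Ocbi : O (c * (b * i)) by apply: OM => //; exact: bJ.
    exists (u + c * b), (j + c * i), (c * (c * (b * i))); split.
    - by split; [exact: Pb.1 | exact: Pu.2].
    - exact: OM.
    - rewrite (_ : _ * w = (c * (b * i)) * (c * w)); last by ring.
      exact: jacobsonM.
    - move=> Jd; apply: Jcbi; rewrite -mulrA; apply: (@jacobson_root 2) => //.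
      rewrite (_ : _ ^+ 2 = (b * i) * (c * (c * (b * i)))); last by ring.
      by apply: jacobsonM => //; exact: bJ.
    - rewrite (_ : _ - _ = c * u * i + c * b * j); last by rewrite /w; ring.
      exact: jacobsonD.
  have sub y : N (u, j) y -> N (u', j') y.
    move=> [Oy Ny]; split=> // r Or /= Jr; apply: Ny => //=; rewrite -/w.
    have Orw : O (r * w) by exact: OM.
    apply: (@jacobson_root 2) => //.
    rewrite (_ : (r * w) ^+ 2 = (r * w) * (r * (u' * j')) -
      ((r * w * r) * (u' * j' - w - d) + (r * r) * (d * w))); last by ring.
    apply: jacobsonB; first exact: jacobsonM.
    by apply: jacobsonD; apply: jacobsonM; do ?exact: OM.
  (* By maximality u' j' lies in the double annihilator of w, so d kills it; then d^2, hence d, is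
     in J. *)
  have [|_ /(_ d Od Jdw)] := maxuj (u', j') (conj u'J Jj') sub (u' * j').
    by split; [exact: u'J | move=> c'].
  move=> Jdw'; apply: Jd; apply: (@jacobson_root 2) => //.
  rewrite (_ : d ^+ 2 = d * (u' * j') - (d * (u' * j' - w - d) + d * w));
    last by ring.
  by apply: jacobsonB => //; apply: jacobsonD => //; exact: jacobsonM.
have [z Oz wz] := regular_mod_jacobson_unit Ow regw.
exists j; split=> //; first by apply/unitrPr; exists (u * z);
  rewrite mulrCA mulrA.
move=> y Jy; exists (u * y * z); first by apply: OM => //; exact: uJ.
by rewrite -[LHS]mul1r -wz /w; ring.
Qed.

Hypothesis perfectA : forall a : A, exists b, a - b ^+ p \in m.

Lemma frobenius_sum n (f : 'I_n -> F) : (\sum_i f i) ^+ p = \sum_i f i ^+ p.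
Proof.
by rewrite -(pFrobenius_autE charF) rmorph_sum.
Qed.

(* The powers b^(p^i) satisfy an A-linear relation modulo J; as the coefficients
   are p-th powers modulo J, a p-th root can be extracted until the coefficient of
   b is a unit. *)
Lemma frobenius_surjective b : O b -> exists2 e, O e & J (b - e ^+ p).
Proof.
move=> Ob; have p_gt0 := ltnW p_gt1.
have OS n (c : nat -> A) : O (\sum_(i < n) iota (c i) * b ^+ (p ^ i)).
  elim/big_ind: _ => [|v w|i _]; [exact: O0 | exact: OD |].
  by apply: OM; [exact: OA | exact: OX].
suff lin n (c : nat -> A) : c n \notin m ->
    J (\sum_(i < n.+1) iota (c i) * b ^+ (p ^ i)) ->
    exists2 e, O e & J (b - e ^+ p).
  pose N n y := exists c : nat -> A, y = \sum_(i < n) iota (c i) * b ^+ (p ^ i).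
  have [||n _ maxn] := @submodule_max nat (fun _ => True) N 0%N => //.
    move=> n _; split.
    - exists (fun=> 0); rewrite big1 // => i _; by rewrite rmorph0 mul0r.
    - move=> a _ _ [c ->] [c' ->]; exists (fun i => a * c i + c' i).
      rewrite mulr_sumr -big_split; apply: eq_bigr => i _ /=.
      by rewrite rmorphD rmorphM; ring.
    - by move=> _ [c ->].
  have [||c bn] := maxn n.+1 I _ (b ^+ (p ^ n)).
  - move=> _ [c ->]; exists (fun i => if (i < n)%N then c i else 0).
    rewrite big_ord_recr /= ltnn rmorph0 mul0r addr0.
    by apply: eq_bigr => i _; rewrite ltn_ord.
  - exists (fun i => if (i < n)%N then 0 else 1).
    rewrite big_ord_recr /= ltnn rmorph1 mul1r big1 ?add0r // => i _.
    by rewrite ltn_ord rmorph0 mul0r.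
  apply: (lin n (fun i => if (i < n)%N then c i else -1)).
    by rewrite ltnn in_m rmorphN rmorph1 oppr_eq0 oner_eq0.
  rewrite big_ord_recr /= ltnn rmorphN1 mulN1r.
  under eq_bigr do rewrite ltn_ord.
  by rewrite -bn subrr; exact: jacobson0.
(* Modulo J the tail of a relation is a p-th power, its coefficients being p-th powers modulo m. *)
have shift l (c' : nat -> A) : exists d : nat -> A,
    (forall i, c' i.+1 - d i ^+ p \in m) /\
    J (\sum_(i < l) iota (c' i.+1) * b ^+ (p ^ i.+1) -
       (\sum_(i < l) iota (d i) * b ^+ (p ^ i)) ^+ p).
  have /choice[d dP] i := perfectA (c' i.+1); exists d; split=> //.
  rewrite frobenius_sum -sumrB; elim/big_ind: _ => [|v w|i _].
  - exact: jacobson0.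
  - exact: jacobsonD.
  rewrite exprMn -exprM -expnSr -mulrBl -rmorphXn -rmorphB mulrC.
  by apply: jacobsonM; [exact: OX | apply/jacobson_iota].
elim: n c => [|n IHn] c cn.
  rewrite big_ord1 expn0 expr1 => Jc.
  have [c' cc'] := unit_notin_maximal noetherianA localm cn.
  exists 0 => //; rewrite expr0n gtn_eqF // subr0.
  rewrite -[b]mul1r -(rmorph1 iota) -cc' rmorphM [iota (c 0%N) * _]mulrC -mulrA.
  by apply: jacobsonM => //; exact: OA.
rewrite big_ord_recl /= expn0 expr1 => Jc.
(* If c_0 is in m, the tail alone is in J and its p-th root is a shorter relation; otherwise the
   relation is solved for b. *)
have [c0m|c0m] := boolP (c 0%N \in m).
  have [d [dP Jd]] := shift n.+1 c; apply: (IHn d).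
    apply: contra cn => dn; have := dP n; rewrite !in_m rmorphB rmorphXn.
    by move: dn; rewrite in_m => /eqP->; rewrite expr0n gtn_eqF // subr0.
  apply: (@jacobson_root p) => //.
  rewrite (_ : _ ^+ p = (iota (c 0%N) * b +
      \sum_(i < n.+1) iota (c i.+1) * b ^+ (p ^ i.+1)) - b * iota (c 0%N) -
    (\sum_(i < n.+1) iota (c i.+1) * b ^+ (p ^ i.+1) -
     (\sum_(i < n.+1) iota (d i) * b ^+ (p ^ i)) ^+ p)); last by ring.
  apply: jacobsonB => //; apply: jacobsonB => //.
  by apply: jacobsonM => //; apply/jacobson_iota.
have [c' cc'] := unit_notin_maximal noetherianA localm c0m.
have [d [_ Jd]] := shift n.+1 (fun i => - c' * c i).
exists (\sum_(i < n.+1) iota (d i) * b ^+ (p ^ i)) => //.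
have E : \sum_(i < n.+1) iota (- c' * c i.+1) * b ^+ (p ^ i.+1) =
    - iota c' * \sum_(i < n.+1) iota (c i.+1) * b ^+ (p ^ i.+1).
  rewrite mulr_sumr; apply: eq_bigr => i _.
  by rewrite rmorphM rmorphN mulrA.
move: Jd; rewrite E => Jd.
have cc'F : iota (c 0%N) * iota c' = 1 by rewrite -rmorphM cc' rmorph1.
rewrite (_ : b - _ = iota c' * (iota (c 0%N) * b +
    \sum_(i < n.+1) iota (c i.+1) * b ^+ (p ^ i.+1)) +
  (- iota c' * \sum_(i < n.+1) iota (c i.+1) * b ^+ (p ^ i.+1) -
   (\sum_(i < n.+1) iota (d i) * b ^+ (p ^ i)) ^+ p)); last by ring: cc'F.
by apply: jacobsonD => //; apply: jacobsonM => //; exact: OA.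
Qed.

Lemma frobenius_iter_surjective n b : O b ->
  exists2 e, O e & J (b - e ^+ (p ^ n)).
Proof.
elim: n b => [|n IHn] b Ob.
  by exists b => //; rewrite expn0 expr1 subrr; exact: jacobson0.
have [c Oc Jc] := frobenius_surjective Ob; have [e Oe Je] := IHn c Oc.
exists e => //; rewrite -(subrKA (c ^+ p)); apply: jacobsonD => //.
rewrite expnSr exprM -{1}(addrNK (e ^+ (p ^ n)) c) -[p in X in J X]expn1.
rewrite (frobeniusD _ _ _ charF) addrK expn1.
exact/jacobsonX/ltnW.
Qed.

End Conductor.
End Normalisation.

(** * Triviality of the symbols {1 - z, v} *)

Section SymbolInduction.
Variables (A : comNzRingType) (m : {pred A}) (k : fieldType).
Variable pi : {rmorphism A -> k}.
Hypotheses (noetherianA : noetherian_ring A) (reducedA : reduced_ring A).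
Hypotheses (localm : local_ring_at m) (residue_pi : is_residue_field pi).
Hypothesis dimA : has_krull_dim A 1.
Variables (F : comUnitRingType) (iota : {rmorphism A -> F}).
Hypothesis quotient_iota : is_total_quotient_ring iota.
Variables (p : nat) (g : A).
Hypotheses (charA : p \in [pchar A]) (regg : GRing.lreg g).
Hypothesis gO : forall y, integralOver iota y ->
  exists2 a, a \in m & iota a = iota g * y.
Hypothesis perfectA : forall a : A, exists b, a - b ^+ p \in m.

Let O (y : F) := integralOver iota y.
Let J := jacobson iota g.
Let O1 : O 1 := integral1 iota.
Let OA a : O (iota a) := integral_id iota a.
Let OD y z : O y -> O z -> O (y + z) := @integral_add _ _ iota y z.
Let OB y z : O y -> O z -> O (y - z) := @integral_sub _ _ iota y z.
Let ON y : O y -> O (- y) := @integral_opp _ _ iota y.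
Let OM y z : O y -> O z -> O (y * z) := @integral_mul _ _ iota y z.
Let OX n y : O y -> O (y ^+ n) := @integral_exp _ _ iota n y.

Let JM y z : O z -> J y -> J (z * y) := @jacobsonM _ _ iota g y z.
Let JD y z : J y -> J z -> J (y + z) := @jacobsonD _ _ iota p g charA y z.
Let JN y : J y -> J (- y) := @jacobsonN _ _ iota g y.
Let JX n y : J y -> (0 < n)%N -> J (y ^+ n) := @jacobsonX _ _ iota g n y.
Let JO y : J y -> O y := @jacobson_integral _ _ iota g y.

Let charF : p \in [pchar F]. Proof. exact: rmorph_pchar charA. Qed.

Variable t : F.
Hypotheses (Jt : J t) (Ut : t \is a GRing.unit).
Hypothesis J_principal : forall y, J y -> exists2 z, O z & y = t * z.

(* F is von Neumann regular: e is made invertible by adding t on the idempotent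
   component where it vanishes. *)
Lemma regular_lift e : O e -> exists e', [/\ O e', e' \is a GRing.unit & J (e -
  e')].
Proof.
move=> Oe; case: quotient_iota => inj_iota unit_iota frac.
have [a [s [regs eE]]] := frac e.
have [b [ab regab]] := regular_complement noetherianA reducedA a.
have Us := unit_iota _ regs; have Uab := unit_iota _ regab.
have abF : iota a * iota b = 0 by rewrite -rmorphM ab rmorph0.
(* As a b = 0 and a + b is regular, [eps] is the idempotent of the components where a, hence e,
   vanishes. *)
pose c := iota (a + b); pose eps := iota b / c.
have Ec : c = iota a + iota b by rewrite /c rmorphD.
have bc : iota b * iota b = iota b * c by rewrite Ec mulrDr [_ * iota a]mulrC
  abF add0r.
have eps2 : eps * eps = eps.
  transitivity ((iota b * iota b) / c / c); first by rewrite /eps; ring.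
  by rewrite bc mulrK.
have Oeps : O eps.
  exists ('X^2 - 'X).
    by rewrite monicE lead_coefDl ?lead_coefXn // size_polyN size_polyX
      size_polyXn.
  apply/rootP; rewrite rmorphB /= map_polyXn map_polyX.
  by rewrite hornerD hornerN hornerXn hornerX expr2 eps2 subrr.
exists (e + t * eps); split.
- by apply: OD => //; apply: OM => //; exact: JO.
- apply/unitrPr; exists (iota s * iota a / c / c + t^-1 * eps).
  have s1 : iota s / iota s = 1 by rewrite mulrV.
  have t1 : t / t = 1 by rewrite mulrV.
  have c1 : c / c = 1 by rewrite mulrV.
  transitivity ((iota s / iota s) * (iota a * iota a) / c / c
     + (iota a * iota b) * (t^-1 / iota s / c + t * iota s / c / c / c)
     + (t / t) * (eps * eps)); first by rewrite eE /eps; ring.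
  rewrite s1 t1 abF mul0r addr0 !mul1r eps2.
  transitivity (((iota a + iota b) * iota a - iota a * iota b) / c / c + iota b
    / c).
    by rewrite /eps; ring.
  rewrite abF subr0 -Ec.
  transitivity ((c / c) * iota a / c + iota b / c); first by ring.
  by rewrite c1 mul1r -mulrDl -Ec.
- rewrite opprD addrA subrr add0r; apply: JN; rewrite mulrC.
  exact: JM.
Qed.

(* sym u v is to be read as: {u, v} belongs to a given subgroup of K2(F). *)
Variable sym : F -> F -> Prop.
Hypothesis symMl : forall u u' v, u \is a GRing.unit -> u' \is a GRing.unit ->
  v \is a GRing.unit -> sym u v -> sym u' v -> sym (u * u') v.
Hypothesis symC : forall u v, u \is a GRing.unit -> v \is a GRing.unit ->
  sym u v -> sym v u.
Hypothesis symVr : forall u v, u \is a GRing.unit -> v \is a GRing.unit ->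
  sym u v -> sym u v^-1.
Hypothesis symX : forall n u v, u \is a GRing.unit -> v \is a GRing.unit ->
  sym (u ^+ n) v <-> sym u (v ^+ n).
Hypothesis sym_Steinberg : forall a, a \is a GRing.unit ->
  1 - a \is a GRing.unit -> sym (1 - a) a.
Variable h : A.
Hypothesis regh : GRing.lreg h.
Hypothesis sym_deep : forall a v, O a -> O v -> v \is a GRing.unit ->
  sym (1 - a * iota h * v) v.

Let symMr u v v' : u \is a GRing.unit -> v \is a GRing.unit ->
  v' \is a GRing.unit -> sym u v -> sym u v' -> sym u (v * v').
Proof.
move=> Uu Uv Uv' uv uv'; apply: symC; rewrite ?unitrM ?Uv //.
by apply: symMl => //; exact: symC.
Qed.

Let symXr n u v : u \is a GRing.unit -> v \is a GRing.unit -> (0 < n)%N ->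
  sym u v -> sym u (v ^+ n).
Proof.
move=> Uu Uv; case: n => // n _ uv; elim: n => [//|n IHn].
by rewrite exprS; apply: symMr; rewrite ?unitrX.
Qed.

Let symKr u v v' : u \is a GRing.unit -> v \is a GRing.unit ->
  v' \is a GRing.unit -> sym u v -> sym u (v * v') -> sym u v'.
Proof.
move=> Uu Uv Uv' uv uvv'; rewrite -(mulKr Uv v').
by apply: symMr; rewrite ?unitrV ?unitrM ?Uv //; exact: symVr.
Qed.

Let sym_coprime i j u v : u \is a GRing.unit -> v \is a GRing.unit ->
  (0 < i)%N -> coprime i j -> sym u (v ^+ i) -> sym u (v ^+ j) -> sym u v.
Proof.
move=> Uu Uv i_gt0 co_ij ui uj; have [a b E _] := egcdnP j i_gt0.
rewrite (eqP co_ij) in E.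
have [a0|a_gt0] := posnP a; first by rewrite a0 mul0n addn1 in E.
have [b0|b_gt0] := posnP b.
  rewrite b0 mul0n add0n in E; rewrite -[v]expr1 -E mulnC exprM.
  by apply: symXr; rewrite ?unitrX.
apply: (@symKr _ (v ^+ (j * b))); rewrite ?unitrX //.
  by rewrite exprM; apply: symXr; rewrite ?unitrX.
rewrite -exprSr -addn1 mulnC -E mulnC exprM.
by apply: symXr; rewrite ?unitrX.
Qed.

Definition integral_unit v := O v /\ exists2 z, O z & v * z = 1.

Let unit_integral_unit v : integral_unit v -> v \is a GRing.unit.
Proof. by case=> _ [z _ vz]; apply/unitrPr; exists z. Qed.

Let one_sub_J y : J y -> integral_unit (1 - y).
Proof.
move=> Jy; split; first by apply: OB => //; exact: JO.
have [z Oz E] := jacobson_unit noetherianA localm residue_pi gO Jy.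
by exists z.
Qed.

(** Symbols with t, which is no unit of O, are included because the descent meets them in z' = e^q
    t^n. *)
Let symbols_trivial n := forall z, O z -> sym (1 - t ^+ n * z) t /\
  forall v, integral_unit v -> sym (1 - t ^+ n * z) v.

Let t_deep : exists N a, O a /\ t ^+ N = iota h * a.
Proof.
exact: (jacobson_nilpotent noetherianA localm residue_pi dimA gO regh Jt).
Qed.

(** The factor v required by [sym_deep] is a spare t when v = t, whence the strict inequality, and
    comes from v v^-1 = 1 when v is a unit of O. *)
Let symbols_deep : exists N, forall n, (N < n)%N -> symbols_trivial n.
Proof.
have [N [a [Oa tN]]] := t_deep; exists N => n /subnK<- z Oz; split.
  rewrite (_ : _ * z = (z * t ^+ (n - N.+1) * a) * iota h * t).
    apply: sym_deep => //; last exact: JO.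
    by apply: OM => //; apply: OM => //; exact/OX/JO.
  by rewrite exprD exprS tN; ring.
move=> v vu; have Uv := unit_integral_unit vu; case: vu => Ov [w Ow vw].
rewrite (_ : _ * z = (z * t ^+ (n - N.+1).+1 * a * w) * iota h * v).
  apply: sym_deep => //; apply: OM => //; apply: OM => //; apply: OM => //.
  exact/OX/JO.
transitivity (t ^+ (n - N.+1 + N.+1) * z * (v * w)).
  by rewrite vw mulr1.
by rewrite exprD [t ^+ N.+1]exprS tN exprS; ring.
Qed.

(* With z' = e^q t^n and n = p^r n0, n0 prime to p, both n0 {1 - z', t} and
   q {1 - z', t} are trivial. For v = e1^q (1 - b), b in J, the Steinberg relation for
   (1 - z') / (1 - z' b) + z' (1 - b) / (1 - z' b) = 1
   expresses {1 - z', 1 - b} by symbols of 1 - z' b, which has order n + 1. *)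
Lemma symbols_descend n : (0 < n)%N -> symbols_trivial n.+1 ->
  symbols_trivial n.
Proof.
move=> n_gt0 Cn; have p_prime := pcharf_prime charA.
have [N [a [Oa tN]]] := t_deep.
(* q exceeds N, so t^q is divisible by h; M is at least n, so the p-part of n divides q. *)
pose M := (N + n).+1; pose q := (p ^ M)%N.
have Mq : (M < q)%N by apply: ltn_expl; exact: prime_gt1.
have q_gt0 : (0 < q)%N by apply: leq_trans Mq.
have frob_sub i (y : F) : (1 - y) ^+ (p ^ i) = 1 - y ^+ (p ^ i).
  by apply/eqP; rewrite eq_sym subr_eq -(frobeniusD _ _ _ charF) subrK expr1n.
(* Frobenius gives {1 - y, x^q} = {1 - y^q, x}, which is deep. *)
have sym_pow y x b : 1 - y \is a GRing.unit -> O x -> x \is a GRing.unit ->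
    O b -> y ^+ q = b * iota h * x -> sym (1 - y) (x ^+ q).
  by move=> Uy Ox Ux Ob E; apply/symX => //; rewrite frob_sub E; exact:
    sym_deep.
have tN_deep i : (N <= i)%N -> exists2 b, O b & t ^+ i = iota h * b.
  move=> /subnK<-; exists (t ^+ (i - N) * a); first exact/OM/Oa/OX/JO.
  by rewrite exprD tN; ring.
move=> z Oz.
have [e0 Oe0 Je0] := frobenius_iter_surjective noetherianA localm residue_pi
  dimA
  quotient_iota charA regg gO perfectA M Oz.
have [e [Oe Ue Je]] := regular_lift Oe0.
have {e0 Oe0 Je0 Je} Jze : J (z - e ^+ q).
  rewrite -(subrKA (e0 ^+ q)); apply: JD => //.
  have -> : e0 ^+ q - e ^+ q = (e0 - e) ^+ q.
    by rewrite -{1}(subrK e e0) (frobeniusD _ _ _ charF) addrK.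
  exact: JX.
pose z' := e ^+ q * t ^+ n.
have Jz' : J z' by apply: JM; [exact: OX | exact: JX].
have Uz' : z' \is a GRing.unit by rewrite unitrM !unitrX.
have z'_unit := one_sub_J Jz'; have U1z' := unit_integral_unit z'_unit.
(* 1 - t^n z and 1 - z' differ by a factor of order n + 1, handled by [Cn]. *)
suff [symt symu] : sym (1 - z') t /\ forall v, integral_unit v ->
  sym (1 - z') v.
  have [_ [s Os s1]] := z'_unit; have [w Ow zE] := J_principal Jze.
  have -> : 1 - t ^+ n * z = (1 - z') * (1 - t ^+ n.+1 * (w * s)).
    transitivity (1 - z' - t ^+ n.+1 * w * ((1 - z') * s)); last by ring.
    by rewrite s1 mulr1 exprSr -[t ^+ n * t * w]mulrA -zE /z'; ring.
  have [symt' symu'] := Cn (w * s) (OM Ow Os).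
  have U2 : 1 - t ^+ n.+1 * (w * s) \is a GRing.unit.
    apply/unit_integral_unit/one_sub_J; rewrite mulrC; apply: JM; first exact:
      OM.
    exact: JX.
  split; first exact: symMl.
  move=> v vu; have Uv := unit_integral_unit vu.
  by apply: symMl => //; [exact: symu | exact: symu'].
split.
  have [n0 co_p_n0 nE] := pfactor_coprime p_prime n_gt0.
  set r := logn p n in nE.
  have n0_gt0 : (0 < n0)%N by case: (n0) nE => // E; rewrite E in n_gt0.
  have rM : (r <= M)%N.
    apply: leq_trans (ltnW (ltn_expl r (prime_gt1 p_prime))) _.
    apply: leq_trans (_ : n <= M)%N; last by rewrite leqW // leq_addl.
    by rewrite [in X in (_ <= X)%N]nE leq_pmull.
  have qE : q = (p ^ (M - r) * p ^ r)%N by rewrite -expnD subnK.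
  have s_gt0 : (0 < p ^ (M - r))%N by rewrite expn_gt0 prime_gt0.
  (* b is a p^r-th root of z', so {1 - z', t^n0} = {1 - b, t^n}. This follows from {1 - b, b} = 1,
     the symbol {1 - b, e^q} being deep. *)
  pose b := e ^+ (p ^ (M - r)) * t ^+ n0.
  have Jb : J b by apply: JM; [exact: OX | exact: JX].
  have Ub : b \is a GRing.unit by rewrite unitrM !unitrX.
  have U1b := unit_integral_unit (one_sub_J Jb).
  have bz : b ^+ (p ^ r) = e ^+ q * t ^+ n.
    by rewrite exprMn -!exprM -qE -nE.
  apply: (@sym_coprime n0 q) => //; first by rewrite coprime_sym coprimeXl.
    rewrite /z' -bz -frob_sub; apply/symX; rewrite ?unitrX //.
    rewrite -exprM -nE; apply: (@symKr _ (e ^+ q)); rewrite ?unitrX //.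
      have [c Oc cE] : exists2 c, O c & t ^+ (n0 * q) = iota h * c.
        apply: tN_deep; apply: leq_trans (leq_pmull _ n0_gt0).
        by apply: ltnW; apply: leq_trans Mq; rewrite ltnW // !ltnS leq_addr.
      apply: (@sym_pow _ _ (e ^+ (p ^ (M - r) * q).-1 * c)) => //.
        by apply: OM => //; exact: OX.
      rewrite /b exprMn -!exprM cE -{1}(prednK (_ :
        0 < p ^ (M - r) * q)%N) ?muln_gt0 ?s_gt0 //.
      by rewrite exprS; ring.
    rewrite -bz; apply: symXr => //; first by rewrite expn_gt0 prime_gt0.
    exact: sym_Steinberg.
  (* One factor t is kept aside for the second entry, whence the predecessor. *)
  have [c Oc cE] : exists2 c, O c & t ^+ (n * q).-1 = iota h * c.
    apply: tN_deep; rewrite -ltnS prednK ?muln_gt0 ?n_gt0 //.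
    apply: leq_trans (leq_pmull _ n_gt0); apply: leq_trans Mq.
    by rewrite !ltnS leqW // leq_addr.
  apply: (@sym_pow _ _ (e ^+ (q * q) * c)) => //; [exact: JO| |].
    by apply: OM => //; exact: OX.
  rewrite /z' exprMn -!exprM -{1}(prednK (_ : 0 < n * q)%N) ?muln_gt0 ?n_gt0 //.
  by rewrite exprS cE; ring.
move=> v vu; have Uv := unit_integral_unit vu; case: vu => Ov [v' Ov' vv'].
have [e1 Oe1 Je1] := frobenius_iter_surjective noetherianA localm residue_pi
  dimA
  quotient_iota charA regg gO perfectA M Ov.
have [y Oy yE] : exists2 y, O y & e1 ^+ q * y = 1.
  have [_ [y Oy yE]] := one_sub_J (JM Ov' Je1).
  exists (v' * y); first exact: OM.
  rewrite -[RHS]yE -vv'.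
  transitivity (((v * v') - v' * (v - e1 ^+ q)) * y); first by ring.
  by [].
have Ue1q : e1 ^+ q \is a GRing.unit by apply/unitrPr; exists y.
have e1y : e1 * (e1 ^+ q.-1 * y) = 1 by rewrite mulrA -exprS prednK.
have Ue1 : e1 \is a GRing.unit by apply/unitrPr; exists (e1 ^+ q.-1 * y).
pose b := - (y * (v - e1 ^+ q)).
have Jb : J b by apply/JN/JM.
have vE : v = e1 ^+ q * (1 - b).
  transitivity (e1 ^+ q + (e1 ^+ q * y) * (v - e1 ^+ q)); last by rewrite /b;
    ring.
  by rewrite yE; ring.
have z'q c : exists2 d, O d & (z' * c) ^+ q = c ^+ q * d * iota h * e.
  have [d Od dE] : exists2 d, O d & t ^+ (n * q) = iota h * d.
    apply: tN_deep; apply: leq_trans (leq_pmull _ n_gt0).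
    by apply: ltnW; apply: leq_trans Mq; rewrite ltnW // !ltnS leq_addr.
  exists (e ^+ (q * q).-1 * d); first by apply: OM => //; exact: OX.
  rewrite exprMn /z' exprMn -!exprM dE -{1}(prednK (_ :
    0 < q * q)%N) ?muln_gt0 ?q_gt0 //.
  by rewrite exprS; ring.
have b_unit := one_sub_J Jb; have U1b := unit_integral_unit b_unit.
rewrite vE; apply: symMr => //.
  have [d Od dE] := z'q 1.
  apply: (@sym_pow _ _ (d * e * (e1 ^+ q.-1 * y))) => //.
    by do ![apply: OM => //]; exact: OX.
  rewrite -[z']mulr1 dE expr1n mul1r.
  transitivity (d * e * iota h * (e1 * (e1 ^+ q.-1 * y))); last by ring.
  by rewrite e1y; ring.
pose P := 1 - z' * b.
have Jzb : J (z' * b) by apply: JM => //; exact: JO.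
have P_unit := one_sub_J Jzb; have UP := unit_integral_unit P_unit.
have [b1 Ob1 bE] := J_principal Jb.
have [symPt symPu] : sym P t /\ forall v, integral_unit v -> sym P v.
  have -> : P = 1 - t ^+ n.+1 * (e ^+ q * b1) by rewrite /P bE exprS /z'; ring.
  by apply: Cn; apply: OM => //; exact: OX.
have symPz : sym P z'.
  apply: symMr; rewrite ?unitrX //; last exact: symXr.
  have [d Od dE] := z'q b.
  by apply: (sym_pow _ _ _ UP Oe Ue _ dE); apply: OM => //; exact/OX/JO.
pose V := z' * ((1 - b) / P).
have U1bP : (1 - b) / P \is a GRing.unit by rewrite unitrM unitrV U1b.
have UV : V \is a GRing.unit by rewrite unitrM Uz'.
have VE : 1 - V = (1 - z') / P.
  have VP : V * P = z' * (1 - b) by rewrite /V mulrA mulrVK.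
  by apply: (mulIr UP); rewrite mulrVK // mulrBl VP mul1r /P; ring.
have symPV : sym P V.
  apply: symMr => //; apply: symMr; rewrite ?unitrV //; first exact: symPu.
  by apply: symVr => //; exact: symPu.
have symzV : sym (1 - z') V.
  rewrite -(mulrVK UP (1 - z')) -VE; apply: symMl => //.
    by rewrite VE unitrM U1z' unitrV.
  by apply: sym_Steinberg => //; rewrite VE unitrM U1z' unitrV.
have symzb : sym (1 - z') ((1 - b) / P).
  by apply: (@symKr _ z') => //; exact: sym_Steinberg.
rewrite -(mulrVK UP (1 - b)); apply: symMr => //.
by apply: symC => //; exact: symPu.
Qed.

Lemma sym_trivial z v : J z -> integral_unit v -> sym (1 - z) v.
Proof.
move=> Jz vu; have [N CN] := symbols_deep.
(* The order runs from N + 2 down to 1, where truncated subtraction holds it. *)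
have C1 i : symbols_trivial (N.+1 - i).+1.
  elim: i => [|i IHi]; first by rewrite subn0; exact/CN/leqW.
  rewrite subnS; case: (N.+1 - i)%N IHi => // j Cj.
  exact: symbols_descend Cj.
have [w Ow ->] := J_principal Jz.
by have := C1 N.+1; rewrite subnn => /(_ w Ow)[_]; rewrite expr1; apply.
Qed.

End SymbolInduction.

(** * Detection *)

Section CoordinateDerivations.
Variables (A : comNzRingType) (m : {pred A}) (k : fieldType).
Variable pi : {rmorphism A -> k}.
Hypotheses (noetherianA : noetherian_ring A).
Hypotheses (localm : local_ring_at m) (residue_pi : is_residue_field pi).
Variable p : nat.
Hypothesis charA : p \in [pchar A].
Hypothesis perfectA : forall a : A, exists b, a - b ^+ p \in m.

(** The recursive form of the ideal generated by s gives direct access to the coefficient of its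
    head. *)
Fixpoint in_span (s : seq A) (z : A) : Prop :=
  if s is x :: s' then exists a z', in_span s' z' /\ z = a * x + z' else z = 0.

Lemma in_spanP s z : in_span s z <->
  exists c : 'I_(size s) -> A, z = \sum_(i < size s) c i * s`_i.
Proof.
elim: s z => [|x s IHs] z /=.
  split=> [->|[c ->]]; last by rewrite big_ord0.
  by exists (fun=> 0); rewrite big_ord0.
split=> [[a [z' [/IHs[c ->] ->]]]|[c ->]].
  exists (fun i => if unlift ord0 i is Some j then c j else a).
  rewrite big_ord_recl unlift_none /=; congr (_ + _).
  by apply: eq_bigr => i _; rewrite liftK.
rewrite big_ord_recl /=; exists (c ord0), (\sum_(i < size s) c (lift ord0 i) *
  s`_i).
by split=> //; apply/IHs; exists (fun i => c (lift ord0 i)).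
Qed.

Lemma in_span0 s : in_span s 0.
Proof. by elim: s => //= x s IHs; exists 0, 0; rewrite mul0r addr0. Qed.

Lemma in_spanD s y z : in_span s y -> in_span s z -> in_span s (y + z).
Proof.
elim: s y z => [|x s IHs] y z /=; first by move=> -> ->; rewrite addr0.
move=> [a [y' [sy ->]]] [b [z' [sz ->]]]; exists (a + b), (y' + z').
by split; [exact: IHs | ring].
Qed.

Lemma in_spanM s c z : in_span s z -> in_span s (c * z).
Proof.
elim: s z => [|x s IHs] z /=; first by move=> ->; rewrite mulr0.
move=> [a [z' [sz ->]]]; exists (c * a), (c * z').
by split; [exact: IHs | ring].
Qed.

Lemma in_span_head x s : in_span (x :: s) x.
Proof. by exists 1, 0; rewrite mul1r addr0; split; first exact: in_span0. Qed.

Section Coordinate.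
Variables (w : A) (s : seq A).
Hypothesis genm : forall z, z \in m <-> in_span (w :: s) z.
Hypothesis minm : ~ forall z, z \in m <-> in_span s z.

Let in_m := in_maximal localm residue_pi.

(** A unit coefficient would express w through s, and s alone would generate m. *)
Lemma relation_maximal a z : in_span s z -> a * w + z = 0 -> a \in m.
Proof.
move=> sz E; apply/negPn/negP => /(unit_notin_maximal noetherianA localm)[b ab].
apply: minm => y; split=> [/genm[c [y' [sy ->]]]|sy]; last first.
  by apply/genm; exists 0, y; rewrite mul0r add0r.
have -> : w = - b * z.
  transitivity (b * (a * w + z) - b * z); last by rewrite E mulr0 sub0r mulNr.
  by rewrite -[LHS]mul1r -ab; ring.
by apply: in_spanD => //; rewrite mulrA; exact: in_spanM.
Qed.

Let coord a c := exists b e z, [/\ in_span s z, a = b ^+ p + e * w + z & pi e =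
  c].

Let wm : w \in m. Proof. by apply/genm; exact: in_span_head. Qed.

Let span_m z : in_span s z -> z \in m.
Proof. by move=> sz; apply/genm; exists 0, z; rewrite mul0r add0r. Qed.

Let frobD (x y : A) : (x + y) ^+ p = x ^+ p + y ^+ p.
Proof. by have := frobeniusD 1 x y charA; rewrite !expn1. Qed.

Let coord_total a : exists c, coord a c.
Proof.
have [b /genm[e [z [sz E]]]] := perfectA a.
by exists (pi e), b, e, z; split; rewrite // -addrA -E addrC subrK.
Qed.

Let pi_coord b e z : in_span s z -> pi (b ^+ p + e * w + z) = pi b ^+ p.
Proof.
move=> /span_m; rewrite in_m !rmorphD rmorphM rmorphXn => /eqP->.
by move: wm; rewrite in_m => /eqP->; rewrite mulr0 !addr0.
Qed.

(** Two choices of b differ by an element of m; as p > 1, its p-th power has a w-coefficient in m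
    and does not affect c. *)
Let coord_fun a c c' : coord a c -> coord a c' -> c = c'.
Proof.
move=> [b [e [z [sz -> <-]]]] [b' [e' [z' [sz' E <-]]]].
have p_gt1 := prime_gt1 (pcharf_prime charA).
have bb' : (b - b') ^+ p = b ^+ p - b' ^+ p.
  by rewrite -[in RHS](subrK b' b) [in RHS]frobD addrK.
have bm : b - b' \in m.
  have := congr1 pi E; rewrite !pi_coord // => /eqP; rewrite -subr_eq0.
  rewrite -!rmorphXn -rmorphB -bb' -in_m.
  exact: (maximalX localm residue_pi).
have [f [z2 [sz2 bE]]] := (genm _).1 bm.
pose u := (b - b') ^+ p.-1.
have um : u \in m.
  move: bm; rewrite !in_m rmorphXn => /eqP->; rewrite expr0n.
  by case: (p) p_gt1 => [|[]].
have : u * f + (e - e') \in m.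
  apply: (@relation_maximal _ (u * z2 + (z - z'))).
    apply: in_spanD; first exact: in_spanM.
    by rewrite -[- z']mulN1r; apply: in_spanD => //; exact: in_spanM.
  transitivity (u * (f * w + z2) + (e * w + z) - (e' * w + z')); first by ring.
  rewrite -bE /u -exprSr prednK ?(ltnW p_gt1) // bb'.
  transitivity ((b ^+ p + e * w + z) - (b' ^+ p + e' * w + z')); first by ring.
  by rewrite E subrr.
move: um; rewrite !in_m rmorphD rmorphM rmorphB => /eqP->.
by rewrite mul0r add0r subr_eq0 => /eqP.
Qed.

(* The w-coordinate of a - b^p, where b^p is a lift of the residue class of a that
   is unique modulo the square of m. *)
Lemma coordinate_derivation : exists d : A -> k,
  [/\ {morph d : a b / a + b}, forall a b, d (a * b) = pi a * d b + d a * pi b,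
      d w = 1 & forall z, in_span s z -> d z = 0].
Proof.
have [d dP] := choice coord_total.
have p_gt0 : (0 < p)%N := prime_gt0 (pcharf_prime charA).
exists d; split.
- move=> a a'; have [b [e [z [sz aE dE]]]] := dP a.
  have [b' [e' [z' [sz' aE' dE']]]] := dP a'.
  apply: (coord_fun (dP _)); exists (b + b'), (e + e'), (z + z'); split.
  + exact: in_spanD.
  + by rewrite frobD {1}aE {1}aE'; ring.
  + by rewrite rmorphD dE dE'.
- move=> a a'; have [b [e [z [sz aE dE]]]] := dP a.
  have [b' [e' [z' [sz' aE' dE']]]] := dP a'.
  apply: (coord_fun (dP _)).
  exists (b * b'), (b ^+ p * e' + e * a'), (b ^+ p * z' + a' * z); split.
  + by apply: in_spanD; exact: in_spanM.
  + by rewrite {1}aE {1}aE' exprMn [in RHS]aE'; ring.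
  + by rewrite rmorphD !rmorphM rmorphXn dE dE' {2}aE pi_coord.
- apply: (coord_fun (dP _)); exists 0, 1, 0; split; rewrite ?rmorph1 //.
    exact: in_span0.
  by rewrite expr0n gtn_eqF // mul1r add0r addr0.
- move=> z sz; apply: (coord_fun (dP _)); exists 0, 0, z; split;
    rewrite ?rmorph0 //.
  by rewrite expr0n gtn_eqF // mul0r !add0r.
Qed.

End Coordinate.
End CoordinateDerivations.

(** * The subgroup of St(F) coming from words with coefficients in ker d *)

Section HorizontalImage.
Variables (A k : comNzRingType) (F : comUnitRingType).
Variables (pi : {rmorphism A -> k}) (iota : {rmorphism A -> F}) (d : A -> k).
Hypothesis dD : {morph d : a b / a + b}.
Hypothesis dM : forall a b, d (a * b) = pi a * d b + d a * pi b.

Definition horizontal_image (x : St F) :=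
  exists2 w : st_word A, horizontal d w & x = \pi_(St F) (word_map iota w).

Lemma horizontal_imageM x y :
  horizontal_image x -> horizontal_image y -> horizontal_image (x * y)%g.
Proof.
move=> [v hv ->] [w hw ->]; exists (v ++ w).
  by rewrite /horizontal all_cat; apply/andP.
by rewrite St_mulE /word_map map_cat.
Qed.

Lemma pi_word_inv (w : st_word F) :
  \pi_(St F) (word_inv w) = ((\pi_(St F) w)^-1)%g.
Proof.
apply/esym/mulg1_eq; rewrite St_mulE.
by apply/eqP/St_eqP; exact: word_invr.
Qed.

Lemma word_map_inv (w : st_word A) :
  word_map iota (word_inv w) = word_inv (word_map iota w).
Proof.
rewrite /word_map /word_inv map_rev -!map_comp; congr rev.
by apply: eq_map => -[b []].
Qed.

Lemma horizontal_word_inv (w : st_word A) : horizontal d w ->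
  horizontal d (word_inv w).
Proof. by rewrite /horizontal /word_inv all_rev all_map. Qed.

Lemma horizontal_imageV x : horizontal_image x -> horizontal_image (x^-1)%g.
Proof.
move=> [w hw ->]; exists (word_inv w); first exact: horizontal_word_inv.
by rewrite word_map_inv pi_word_inv.
Qed.

Lemma horizontal_image_stx i j a : i != j -> d a = 0 ->
  horizontal_image (stx i j (iota a)).
Proof.
move=> ij da; exists [:: x_ ij a]; first by rewrite /horizontal /= da eqxx.
by rewrite (stxE ij).
Qed.

Let d1 := derivation1 dM.
Let dN := derivationN dD.

Lemma horizontal_image_stw i j a b : i != j -> a * b = 1 -> d a = 0 ->
  horizontal_image (stw i j (iota a)).
Proof.
move=> ij ab da; have db : d b = 0 := derivation_inv dM ab da.
have ji : j != i by rewrite eq_sym.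
have Ua : iota a \is a GRing.unit.
  by apply/unitrPr; exists (iota b); rewrite -rmorphM ab rmorph1.
have abF : (iota a)^-1 = iota b.
  by apply: (mulrI Ua); rewrite mulrV // -rmorphM ab rmorph1.
rewrite /stw abF -rmorphN.
by do ?[apply: horizontal_imageM]; apply: horizontal_image_stx => //;
  rewrite dN db oppr0.
Qed.

(** b is inverted only in F: the Dennis-Stein form involves a, b, 1 - a b and its inverse, all
    coming from ker d. *)
Lemma horizontal_image_symbol i j a b u' : i != j -> d a = 0 -> d b = 0 ->
    (1 - a * b) * u' = 1 -> iota b \is a GRing.unit ->
  horizontal_image (symbol i j (1 - iota a * iota b)%R (iota b)).
Proof.
move=> ij da db uu' Ub; have ji : j != i by rewrite eq_sym.
set u := 1 - a * b in uu'.
have uE : 1 - iota a * iota b = iota u by rewrite rmorphB rmorph1 rmorphM.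
have uuF : iota u * iota u' = 1 by rewrite -rmorphM uu' rmorph1.
have Uu : iota u \is a GRing.unit by apply/unitrPr; exists (iota u').
have uV : (iota u)^-1 = iota u' by apply: (mulrI Uu); rewrite mulrV.
have du : d u = 0 by rewrite dD d1 add0r dN dM da db mulr0 mul0r addr0 oppr0.
have du' : d u' = 0 := derivation_inv dM uu' du.
rewrite uE (symbol_Dennis_Stein ij Uu Ub (esym uE)) uV.
rewrite -(rmorph1 iota) -!rmorphM -!rmorphN.
apply: horizontal_imageM; last first.
  by apply: (@horizontal_image_stw _ _ _ 1); rewrite ?mulr1.
apply: horizontal_imageM; last first.
  by apply: (@horizontal_image_stw _ _ _ (- u'));
    rewrite ?mulrNN // dN du oppr0.
repeat apply: horizontal_imageM; apply: horizontal_image_stx => //.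
- by rewrite dN db oppr0.
- by rewrite dN dM da du' mulr0 mul0r addr0 oppr0.
- by rewrite dM du db mulr0 mul0r addr0.
Qed.

Lemma pi_symbol_word i j (ij : i != j) (ji : j != i) (u u' v v' : A) :
    u * u' = 1 -> v * v' = 1 ->
  \pi_(St F) (word_map iota (symbol_word ij ji u u' v v')) =
    symbol i j (iota u) (iota v).
Proof.
have weylE a a' : a * a' = 1 ->
    \pi_(St F) (word_map iota (weyl_word ij ji a a')) = stw i j (iota a).
  move=> aa'; have aaF : iota a * iota a' = 1 by rewrite -rmorphM aa' rmorph1.
  have Ua : iota a \is a GRing.unit by apply/unitrPr; exists (iota a').
  have aV : (iota a)^-1 = iota a' by apply: (mulrI Ua); rewrite mulrV.
  rewrite /stw aV -rmorphN (stxE ij) (stxE ji).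
  by rewrite (St_mulE [:: _] [:: _]) (St_mulE [:: _; _] [:: _]).
move=> uu' vv'; rewrite /symbol_word /word_map !map_cat -!/(word_map _ _).
rewrite -3!St_mulE !weylE ?mulrNN ?mulr1 //; last first.
  by rewrite mulrACA uu' vv' mulr1.
have Uu : iota u \is a GRing.unit.
  by apply/unitrPr; exists (iota u'); rewrite -rmorphM uu' rmorph1.
have Uv : iota v \is a GRing.unit.
  by apply/unitrPr; exists (iota v'); rewrite -rmorphM vv' rmorph1.
rewrite /symbol !(sthV ij) // /sth !rmorphN rmorphM rmorph1.
have -> : stw i j (-1) = ((stw i j 1)^-1)%g :> St F by rewrite stwV ?unitr1.
move: (stw _ _ _) (stw _ _ _) (stw _ _ _) (stw _ _ _) => x y z t.
by rewrite !gnorm.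
Qed.

End HorizontalImage.

(** * Words over A that become trivial over F *)

Section Detection.
Variables (A : comNzRingType) (F : comUnitRingType) (iota : {rmorphism A -> F}).
Hypotheses (inj_iota : injective iota) (K2_injective : injective (K2_map iota)).

(** As [iota] is injective, the matrix of w over A is already the identity, so w defines an element
    of K2(A). *)
Lemma K2_injective_word (w : st_word A) :
  \pi_(St F) (word_map iota w) = 1%g -> steinberg_eq w [::].
Proof.
move=> w1; pose z := \pi_(St A) w.
have zK : z \in @in_K2 A.
  apply/in_K2P; apply/funext=> i; apply/funext=> j; apply: inj_iota.
  have := St_mx_map iota z; rewrite /z St_map_pi w1 => /(congr1 (fun M =>
    M i j)).
  rewrite /infmx_map => <-; rewrite /St_mx St_act1 /infmx1.
  by rewrite rmorph_nat.
have : Sub z zK = 1%g :> K2 A.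
  apply: K2_injective; apply: val_inj.
  rewrite /= /z St_map_pi w1.
  by rewrite -[1%g in RHS]/(\pi_(St A) [::]) St_map_pi.
by move/(congr1 val) => /= z1; apply/St_eqP/eqP.
Qed.

End Detection.

(** * Minimal generators of the maximal ideal and the final contradiction *)

Lemma principal_regular_local (A : comNzRingType) (m : {pred A}) (w : A) :
    noetherian_ring A -> local_ring_at m -> has_krull_dim A 1 ->
    (forall z, z \in m <-> exists a, z = a * w) ->
  regular_local_ring A.
Proof.
move=> noetherianA localm dimA mw; split=> //; exists m; split=> //.
exists [:: w]; split=> // z; split=> [/mw[a ->]|[c ->]].
  by exists (fun=> a); rewrite big_ord1.
by rewrite big_ord1; apply/mw; exists (c ord0).
Qed.

Lemma minimal_span (A : comNzRingType) (m : {pred A}) :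
    noetherian_ring A -> idealr_closed m ->
  exists s, (forall z, z \in m <-> in_span s z) /\
    forall s', (forall z, z \in m <-> in_span s' z) -> (size s <= size s')%N.
Proof.
move=> noetherianA /noetherianA[s0 s0P].
have gen0 : forall z, z \in m <-> in_span s0 z.
  by move=> z; rewrite s0P in_spanP.
have ex_n : exists n, `[< exists2 s, size s = n & forall z, z \in m <-> in_span
  s z >].
  by exists (size s0); apply/asboolP; exists s0.
case: (ex_minnP ex_n) => n /asboolP[s <- sP] min_s; exists s; split=> // s' s'P.
by apply: min_s; apply/asboolP; exists s'.
Qed.

(* p \in [pchar A] says that p is prime and that p = 0 in A. *)
Theorem theorem0p3 (p : nat) (A : comNzRingType) (charA : p \in [pchar A])
    (noetherianA : noetherian_ring A) (reducedA : reduced_ring A)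
    (localA : local_ring A) (dimA : has_krull_dim A 1%N)
    (k : fieldType) (pi : {rmorphism A -> k}) (residue_pi : is_residue_field pi)
    (perfect_k : perfect_field k)
    (F : comUnitRingType) (iota : {rmorphism A -> F})
    (quotient_iota : is_total_quotient_ring iota)
    (finiteA : finite_normalisation iota)
    (K2_injective : injective (K2_map iota)) :
  regular_local_ring A.
Proof.
have [m localm] := localA.
have [s [sP min_s]] := minimal_span noetherianA (maximal_idealr localm).
case: s sP min_s => [|x [|y s]] sP min_s.
- apply: (principal_regular_local (w := 0) noetherianA localm dimA) => z.
  by rewrite sP /=; split=> [->|[a ->]]; [exists 0 |]; rewrite mulr0.
- apply: (principal_regular_local (w := x) noetherianA localm dimA) => z.
  rewrite sP /=; split=> [[a [_ [-> ->]]]|[a ->]]; exists a;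
    first by rewrite addr0.
  by exists 0; rewrite addr0.
exfalso.
have in_m := in_maximal localm residue_pi.
have charK : p \in [pchar k] := rmorph_pchar pi charA.
have perfectA (a : A) : exists b, a - b ^+ p \in m.
  have [z zE] := perfect_root charK perfect_k (pi a).
  have [b bz] := residue_pi.1 z; exists b.
  by rewrite in_m rmorphB rmorphXn bz zE subrr.
have swapP z : z \in m <-> in_span (y :: x :: s) z.
  rewrite sP /=; split=> -[a [_ [[b [z' [sz ->]]] ->]]].
    by exists b, (a * x + z'); split; [exists a, z' | ring].
  by exists b, (a * y + z'); split; [exists a, z' | ring].
have no_gen w : ~ forall z, z \in m <-> in_span (w :: s) z.
  by move=> /min_s; rewrite ltnn.
have [d1 [d1D d1M d1x d1s]] := coordinate_derivation noetherianA localm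
  residue_pi
  charA perfectA sP (no_gen y).
have [d2 [d2D d2M d2y d2s]] := coordinate_derivation noetherianA localm
  residue_pi
  charA perfectA swapP (no_gen x).
have d1y : d1 y = 0 by apply: d1s; exact: in_span_head.
have d2x : d2 x = 0 by apply: d2s; exact: in_span_head.
have xm : x \in m by apply/sP; exact: in_span_head.
have ym : y \in m by apply/swapP; exact: in_span_head.
have x0 : x <> 0.
  move=> x0; move: d1x; rewrite x0 (derivation0 d1D) => /esym/eqP.
  by rewrite oner_eq0.
have [g0 g0m reg0] := regular_in_maximal noetherianA reducedA localm residue_pi
  xm x0.
have [g1 [g1m reg1 g1O]] := conductor localm residue_pi quotient_iota finiteA
  g0m reg0.
have [inj_iota unit_iota _] := quotient_iota.
(* With the square, g O lies in the square of m, where d2 vanishes. *)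
pose g := g1 * g1; have regg : GRing.lreg g by exact: GRing.lregM.
have gO v : integralOver iota v ->
    exists a, [/\ a \in m, iota a = iota g * v & d2 a = 0].
  move=> /g1O[a am aE]; exists (g1 * a); split.
  - exact: (maximalM localm residue_pi).
  - by rewrite !rmorphM aE mulrA.
  - move: am g1m; rewrite !in_m => /eqP pa /eqP pg.
    by rewrite d2M pa pg mul0r mulr0 addr0.
have gO2 v : integralOver iota v -> exists2 a, a \in m & iota a = iota g * v.
  by move=> /gO[a [am aE _]]; exists a.
have one_sub a : a \in m -> exists b, (1 - a) * b = 1.
  move=> am; apply: (unit_notin_maximal noetherianA localm).
  by move: am; rewrite !in_m rmorphB rmorph1 => /eqP->; rewrite subr0 oner_eq0.
have [t [Jt Ut J_principal]] := jacobson_principal noetherianA localm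
  residue_pi dimA
  quotient_iota charA regg gO2.
pose sym u v := horizontal_image iota d2 (symbol 0 1 u v).
have n01 : (0 != 1)%N by []. have n10 : (1 != 0)%N by [].
have sym_deep a v : integralOver iota a -> integralOver iota v ->
    v \is a GRing.unit -> sym (1 - a * iota (g * g) * v) v.
  move=> Oa Ov Uv; have Ug := unit_iota _ regg.
  have O1 := integral1 iota.
  have [ga [gam gaE dga]] := gO _ Oa; have [gv [gvm gvE dgv]] := gO _ Ov.
  have [gav [gavm gavE dgav]] := gO _ (integral_mul Oa Ov).
  have [g' [g'm g'E dg']] := gO _ O1.
  rewrite mulr1 in g'E; rewrite (inj_iota _ _ g'E) in g'm dg' => {g' g'E}.
  (* Reading u as 1 - (g a)(g v) treats {u, g v}, reading it as 1 - (g a v) g treats {u, g}; their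
     quotient is {u, v}. *)
  set u := 1 - _; have uE1 : u = 1 - iota ga * iota gv.
    by rewrite /u gaE gvE rmorphM; ring.
  have uE2 : u = 1 - iota gav * iota g by rewrite /u gavE rmorphM; ring.
  have [b bE] := one_sub (ga * gv) (maximalM localm residue_pi ga gvm).
  have [c cE] := one_sub (gav * g) (maximalM localm residue_pi gav g'm).
  have Uu : u \is a GRing.unit.
    apply/unitrPr; exists (iota b);
      rewrite uE1 -rmorphM -(rmorph1 iota) -rmorphB.
    by rewrite -rmorphM bE.
  have sym1 : sym u (iota g * v).
    rewrite uE1 -gvE; apply: (horizontal_image_symbol d2D d2M _ dga dgv bE) =>
      //.
    by rewrite gvE unitrM Ug.
  have sym2 : sym u (iota g).
    by rewrite uE2; apply: (horizontal_image_symbol d2D d2M _ dgav dg' cE).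
  move: sym1; rewrite /sym symbolMr // => sym1.
  rewrite -(mulKg (symbol 0 1 u (iota g)) (symbol 0 1 u v)).
  by apply: horizontal_imageM => //; exact: horizontal_imageV.
have symbolV u v : u \is a GRing.unit -> v \is a GRing.unit ->
    symbol 0 1 u v^-1 = ((symbol 0 1 u v)^-1)%g.
  move=> Uu Uv; apply/esym/mulg1_eq; rewrite -symbolMr ?unitrV // mulrV //.
  by rewrite -(expr0 1) symbolXr ?unitr1.
have [xx xxE] := one_sub x xm; have [yy yyE] := one_sub y ym.
have [w hw wE] : sym (1 - iota x) (1 - iota y).
  apply: (sym_trivial noetherianA reducedA localm residue_pi dimA quotient_iota
    charA regg gO2 perfectA Jt Ut J_principal _ _ _ _ _ (GRing.lregM regg regg)
    sym_deep).
  - by move=> u u' v Uu Uu' Uv; rewrite /sym symbolMl //; exact: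
      horizontal_imageM.
  - by move=> u v Uu Uv; rewrite /sym (symbolC n01 Uu Uv); exact:
      horizontal_imageV.
  - by move=> u v Uu Uv; rewrite /sym symbolV //; exact: horizontal_imageV.
  - by move=> n u v Uu Uv; rewrite /sym symbolXl // symbolXr.
  - by move=> a Ua U1a; rewrite /sym symbol_Steinberg //; exists [::].
  - exact/(jacobson_iota noetherianA localm residue_pi dimA quotient_iota regg
      gO2).
  - split; first by apply: integral_sub; [exact: integral1 | exact:
      integral_id].
    exists (iota yy); first exact: integral_id.
    by rewrite -(rmorph1 iota) -rmorphB -rmorphM yyE.
(* This word dies in St(F), hence in St(A), although its invariant is d1(1 - x) d2(1 - y) = (-1)(-1)
   = 1. *)
pose z := symbol_word n01 n10 (1 - x) xx (1 - y) yy ++ word_inv w.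
have /(steinberg_eq_cocycle (pi := pi) d1D d2D d1M d2M) : steinberg_eq z [::].
  apply: (K2_injective_word inj_iota K2_injective).
  rewrite /z /word_map map_cat -!/(word_map _ _) -St_mulE pi_symbol_word //.
  by rewrite word_map_inv pi_word_inv -wE !rmorphB !rmorph1 mulgV.
move=> /(congr1 (fun f => (f (fun _ _ => 0, 0)).2)).
(* The inverse of w acts first and, being horizontal, leaves the zero state unchanged. *)
rewrite /z cocycle_word_cat (cocycle_horizontal pi d1 d2D); last exact:
  horizontal_word_inv.
have d_sub (d : A -> k) (dD : {morph d : a b / a + b})
    (dM : forall a b, d (a * b) = pi a * d b + d a * pi b) a :
    d (1 - a) = - d a.
  by rewrite dD (derivation1 dM) add0r (derivationN dD).
have pi_sub a : a \in m -> pi (1 - a) = 1.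
  by rewrite in_m rmorphB rmorph1 => /eqP->; rewrite subr0.
rewrite (cocycle_symbol_word d1D d2D d1M d2M) ?(d_sub d1) ?(d_sub d2) //=;
  rewrite ?pi_sub ?d1x ?d1y ?d2x ?d2y ?oppr0 //.
by rewrite mulrNN mulr1 => /eqP; rewrite oner_eq0.
Qed.
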